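(* Any solution of the semi-implicit scheme (S1)--(S2) recalled in the context satisfies the energy inequality $$\frac1{\varepsilon^2}\sum_{K\in\mathcal M}|K|\,\Pi_\gamma(\rho^{n+1}_K|\tilde\rho_K)+\sum_{\sigma\in\mathcal E_{\rm int}}|D_\sigma|\tfrac12\rho^{n+1}_{D_\sigma}(u^{n+1}_\sigma)^2\le\frac1{\varepsilon^2}\sum_{K\in\mathcal M}|K|\,\Pi_\gamma(\rho^{n}_K|\tilde\rho_K)+\sum_{\sigma\in\mathcal E_{\rm int}}|D_\sigma|\tfrac12\rho^{n}_{D_\sigma}(u^{n}_\sigma)^2,$$ under the time-step restriction $$\frac{\delta t}{|D_\sigma|}\sum_{\epsilon\in\tilde{\mathcal E}(D_\sigma)}\frac{F_{\epsilon,\sigma}(\rho^{n+1},\boldsymbol u^n)^-}{\rho^{n+1}_{D_\sigma}}\le\frac12\qquad\forall\sigma\in\mathcal E^{(i)}_{\rm int},\ 1\le i\le d,$$ and the condition on $\eta$ $$\eta\ge\frac1{\rho^{n+1}_{D_\sigma}}\qquad\forall\sigma\in\mathcal E^{(i)}_{\rm int},\ 1\le i\le d.$$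
   Context: Notation: $x^-=\frac12(|x|-x)$ for $x\in\mathbb R$; $\mathcal E_{\rm int}=\bigcup_i\mathcal E^{(i)}_{\rm int}$. Data. $d\in\{1,2,3\}$, $\gamma>1$, $\varepsilon\in(0,1]$; $\Omega\subset\mathbb R^d$ is a bounded open connected set whose closure is a finite union of closed axis-parallel intervals/rectangles/parallelepipeds. $\wp(\rho)=\rho^\gamma$, $h_\gamma(\rho)=\rho^\gamma/(\gamma-1)$ for $\rho>0$, $\Pi_\gamma(a|b)=h_\gamma(a)-h_\gamma(b)-h_\gamma'(b)(a-b)$. $\phi$ is a given smooth potential, and the hydrostatic density is $\tilde\rho(x)=\big(\frac{\gamma-1}{\gamma}(C(m_0)-\phi(x))\big)^{1/(\gamma-1)}$ (so $h_\gamma'(\tilde\rho)+\phi=C(m_0)$), where the constant $C(m_0)$ is determined by the total mass $m_0$; it is assumed bounded below by a positive constant on $\Omega$. Mesh. A MAC grid $\mathcal T=(\mathcal M,\mathcal E)$ consists of a partition $\mathcal M$ of $\bar\Omega$ into closed axis-parallel cells (conforming, possibly non-uniform) and the set $\mathcal E=\bigcup_{i=1}^d\mathcal E^{(i)}$ of their faces, $\mathcal E^{(i)}=\mathcal E^{(i)}_{\rm int}\cup\mathcal E^{(i)}_{\rm ext}$ being the (internal and external) faces orthogonal to the $i$-th canonical vector $e^{(i)}$. $\mathcal E(K)$ is the set of faces of $K$; $\sigma=K|L$ is the internal face common to $K,L$; $\boldsymbol\nu_{\sigma,K}$ is the unit normal to $\sigma$ outward to $K$. For $\sigma=K|L$ the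 dual cell is $D_\sigma=D_{\sigma,K}\cup D_{\sigma,L}$, with $D_{\sigma,K}$ the half of $K$ adjacent to $\sigma$ (for external $\sigma\in\mathcal E(K)$, $D_\sigma=D_{\sigma,K}$); $\tilde{\mathcal E}(D_\sigma)$ is the set of faces of $D_\sigma$, and $\epsilon=D_\sigma|D_{\sigma'}$ denotes a common dual face. $L_{\mathcal M}(\Omega)$: functions constant on each $K\in\mathcal M$. $\boldsymbol H_{\mathcal E,0}(\Omega)$: vector fields $\boldsymbol u$ whose $i$-th component is constant ($=u_\sigma$) on each $D_\sigma$, $\sigma\in\mathcal E^{(i)}$, and zero for $\sigma\in\mathcal E^{(i)}_{\rm ext}$. For $q\in L_{\mathcal M}(\Omega)$, $\sigma=K|L$: $|D_\sigma|q_{D_\sigma}=|D_{\sigma,K}|q_K+|D_{\sigma,L}|q_L$. Interface values and discrete gradient. For a positive $\rho\in L_{\mathcal M}(\Omega)$ and $\sigma=K|L$, $\rho_\sigma$ is the unique number between $\rho_K$ and $\rho_L$ with $\rho_K^\gamma-\rho_L^\gamma=\rho_\sigma(h_\gamma'(\rho_K)-h_\gamma'(\rho_L))$ if $\rho_K\ne\rho_L$, and $\rho_\sigma=\rho_K$ if $\rho_K=\rho_L$. For $\sigma=K|L\in\mathcal E^{(i)}_{\rm int}$, $(\partial^{(i)}_{\mathcal E}q)_\sigma=\frac{|\sigma|}{|D_\sigma|}(q_L-q_K)\,e^{(i)}\cdot\boldsymbol\nu_{\sigma,K}$. Discrete hydrostatic data: $\tilde\rho_K=\frac1{|K|}\int_K\tilde\rho(x)\,dx$,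 $\phi_K=C(m_0)-h_\gamma'(\tilde\rho_K)$. Fluxes. With $p^{n+1}_K=(\rho^{n+1}_K)^\gamma$ and a stabilisation parameter $\eta>0$ (which may be chosen depending on the time level and the interface), $\delta u^{n+1}_\sigma=\frac{\eta\,\delta t}{\varepsilon^2}\big[(\partial^{(i)}_{\mathcal E}p^{n+1})_\sigma+\rho^{n+1}_\sigma(\partial^{(i)}_{\mathcal E}\phi)_\sigma\big]$ for $\sigma\in\mathcal E^{(i)}_{\rm int}$, zero on external faces. $F_{\sigma,K}(\rho^{n+1},\boldsymbol u^n)=|\sigma|\rho^{n+1}_\sigma(u^n_\sigma-\delta u^{n+1}_\sigma)\,e^{(i)}\cdot\boldsymbol\nu_{\sigma,K}$ for $\sigma\in\mathcal E^{(i)}_{\rm int}$, zero on external faces. Dual fluxes $F_{\epsilon,\sigma}$ ($\sigma=K|L\in\mathcal E^{(i)}_{\rm int}$, $\epsilon\in\tilde{\mathcal E}(D_\sigma)$): zero if $\epsilon\subset\partial\Omega$; if $\epsilon\perp e^{(i)}$ lies in $K$, $F_{\epsilon,\sigma}=\frac12(F_{\sigma',K}-F_{\sigma,K})$ with $\sigma'$ the face of $K$ opposite to $\sigma$; otherwise $\epsilon$ consists of halves of faces $\tau\in\mathcal E(K)$, $\tau'\in\mathcal E(L)$ and $F_{\epsilon,\sigma}=\frac12(F_{\tau,K}+F_{\tau',L})$. For $\epsilon=D_\sigma|D_{\sigma'}$, $u^n_{\epsilon,\rm up}=u^n_\sigma$ if $F_{\epsilon,\sigma}\ge0$ and $u^n_{\sigma'}$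 otherwise. Scheme. $\delta t>0$. Given $(\rho^n,\boldsymbol u^n)\in L_{\mathcal M}(\Omega)\times\boldsymbol H_{\mathcal E,0}(\Omega)$ with $\rho^n>0$, a solution is $(\rho^{n+1},\boldsymbol u^{n+1})$ in the same space with $\rho^{n+1}>0$ and (S1) $\frac1{\delta t}(\rho^{n+1}_K-\rho^n_K)+\frac1{|K|}\sum_{\sigma\in\mathcal E(K)}F_{\sigma,K}(\rho^{n+1},\boldsymbol u^n)=0$ for all $K\in\mathcal M$; (S2) $\frac1{\delta t}(\rho^{n+1}_{D_\sigma}u^{n+1}_\sigma-\rho^n_{D_\sigma}u^n_\sigma)+\frac1{|D_\sigma|}\sum_{\epsilon\in\tilde{\mathcal E}(D_\sigma)}F_{\epsilon,\sigma}(\rho^{n+1},\boldsymbol u^n)u^n_{\epsilon,\rm up}+\frac1{\varepsilon^2}(\partial^{(i)}_{\mathcal E}p^{n+1})_\sigma=-\frac1{\varepsilon^2}\rho^{n+1}_\sigma(\partial^{(i)}_{\mathcal E}\phi)_\sigma$ for all $\sigma\in\mathcal E^{(i)}_{\rm int}$, $1\le i\le d$. *)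

(* Defs.v *)
From HB Require Import structures.
From mathcomp Require Import all_boot all_order all_algebra finmap.
From mathcomp Require Import all_classical all_reals all_analysis.

Set Implicit Arguments.
Unset Strict Implicit.
Unset Printing Implicit Defensive.

Import Order.TTheory GRing.Theory Num.Theory.
Import numFieldNormedType.Exports.

Local Open Scope classical_set_scope.
Local Open Scope ring_scope.

(* Product of a measure on T and a measure on n.-tuple T, as a measure on
   n.+1.-tuple T: the image of m1 \x m2 under (x, t) |-> x :: t. *)
Section ConsMeasure.
Context d (T : measurableType d) (R : realType) (n : nat).
Variable m1 : {sigma_finite_measure set T -> \bar R}.
Variable m2 : {sigma_finite_measure set (n.-tuple T) -> \bar R}.

Definition cons_tuple (p : T * n.-tuple T) : n.+1.-tuple T :=
  [tuple of p.1 :: p.2].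

Definition cons_measure : set (n.+1.-tuple T) -> \bar R :=
  pushforward (m1 \x m2)%E cons_tuple.

Lemma measurable_cons_tuple : measurable_fun setT cons_tuple.
Proof. exact: measurable_cons. Qed.

Let m0 : cons_measure set0 = 0%E.
Proof. by rewrite /cons_measure /pushforward preimage_set0 measure0. Qed.

Let m_ge0 A : (0 <= cons_measure A)%E.
Proof. by rewrite /cons_measure /pushforward; exact: measure_ge0. Qed.

Let m_additive : semi_sigma_additive cons_measure.
Proof.
have mf := measurable_cons_tuple.
move=> F mF tF mUF; rewrite /cons_measure /pushforward preimage_bigcup.
apply: measure_semi_sigma_additive.
- by move=> i; rewrite -[X in measurable X]setTI; exact: mf.
- apply/trivIsetP => /= i j _ _ ij; rewrite -preimage_setI.
  by move/trivIsetP : tF => /(_ _ _ _ _ ij) ->//; rewrite preimage_set0.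
- by rewrite -preimage_bigcup -[X in measurable X]setTI; exact: mf.
Qed.

HB.instance Definition _ :=
  isMeasure.Build _ _ _ cons_measure m0 m_ge0 m_additive.

Let m_sigma_finite : sigma_finite setT cons_measure.
Proof.
have /sigma_finiteP[F [TF ndF Foo]] := sigma_finiteT m1.
have /sigma_finiteP[G [TG ndG Goo]] := sigma_finiteT m2.
pose g (t : n.+1.-tuple T) : T * n.-tuple T :=
  (tnth t ord0, [tuple of behead t]).
have gK p : g (cons_tuple p) = p.
  by case: p => x t; congr pair; apply/val_inj.
have mg : measurable_fun setT g.
  apply: measurable_fun_pair; first exact: measurable_tnth.
  exact: measurable_behead.
exists (fun k => g @^-1` (F k `*` G k)).
  apply/seteqP; split => // t _.
  have : (setT `*` setT) (g t) by [].
  rewrite TF TG => -[[i _ Fi] [j _ Gj]]; exists (maxn i j) => //; split.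
    exact: (subsetPset _ _ (ndF _ _ (leq_maxl i j))).
  exact: (subsetPset _ _ (ndG _ _ (leq_maxr i j))).
move=> k; have [mF Fk] := Foo k; have [mG Gk] := Goo k; split.
  by rewrite -[X in measurable X]setTI; apply: mg => //; exact: measurableX.
have gid : g \o cons_tuple = id by apply/funext => p; exact: gK.
rewrite /cons_measure /pushforward -comp_preimage gid preimage_id.
by rewrite product_measure1E// lte_mul_pinfty// ge0_fin_numE.
Qed.

HB.instance Definition _ :=
  Measure_isSigmaFinite.Build _ _ _ cons_measure m_sigma_finite.

End ConsMeasure.

Section Space.
Context {R : realType} {d : nat}.

Fixpoint lebesgue_tuple n :
    {sigma_finite_measure set (n.-tuple (measurableTypeR R)) -> \bar R} :=
  if n is m.+1 then cons_measure (@lebesgue_measure R) (lebesgue_tuple m)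
  else \d_ [tuple].

(* d-dimensional Lebesgue integral, through the identification of row vectors
   with d-tuples, on which the library puts the product sigma-algebra *)
Definition integral_rV (A : set 'rV[R]_d) (f : 'rV[R]_d -> R) : \bar R :=
  let row (t : d.-tuple (measurableTypeR R)) : 'rV[R]_d := \row_j tnth t j in
  (\int[lebesgue_tuple d]_(t in row @^-1` A) (f (row t))%:E)%E.

Fixpoint is_Ck (k : nat) (U : set 'rV[R]_d) (f : 'rV[R]_d -> R) : Prop :=
  (forall x, U x -> {for x, continuous f}) /\
  (if k is k'.+1 then
     forall i : 'I_d, (forall x, U x -> derivable f x 'e_i) /\
                      is_Ck k' U (fun x => 'D_'e_i f x)
   else True).

Definition smooth (U : set 'rV[R]_d) (f : 'rV[R]_d -> R) :=
  forall k, is_Ck k U f.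

(* A box is given by its two extreme corners (b.1 <= b.2 coordinatewise). *)
Definition box : Type := ('rV[R]_d * 'rV[R]_d)%type.

Definition box_set (b : box) : set 'rV[R]_d :=
  [set x | forall i, b.1 0 i <= x 0 i <= b.2 0 i].

Definition nondegenerate (b : box) := forall i, b.1 0 i < b.2 0 i.

Definition vol (b : box) : R := \prod_i (b.2 0 i - b.1 0 i).

Definition set_coord (x : 'rV[R]_d) (i : 'I_d) (c : R) : 'rV[R]_d :=
  \row_j (if j == i then c else x 0 j).

(* A face is a box that is flat in one direction, together with that
   direction; it is used for the faces of the cells and of the dual cells. *)
Definition face : Type := ('I_d * box)%type.

(* the lower (s = false) or upper (s = true) face of b orthogonal to e_i *)
Definition face_of (b : box) (i : 'I_d) (s : bool) : face :=
  let c := (if s then b.2 else b.1) 0 i in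
  (i, (set_coord b.1 i c, set_coord b.2 i c)).

Definition faces (b : box) : {fset face} :=
  [fset face_of b q.1 q.2 | q : 'I_d * bool]%fset.

Definition is_upper (b : box) (f : face) : bool := f == face_of b f.1 true.

(* e_i . nu_(f, b), for a face f of b orthogonal to e_i *)
Definition normal (f : face) (b : box) : R := if is_upper b f then 1 else -1.

(* (d-1)-dimensional measure; it is 1 when d = 1 *)
Definition area (f : face) : R :=
  \prod_(j | j != f.1) (f.2.2 0 j - f.2.1 0 j).

(* Boundary of the closure of Om: this is the boundary of Om for a domain
   lying on one side of its boundary. If Om had slits, a mesh of closure Om
   would not see them. *)
Definition outer_boundary (Om : set 'rV[R]_d) : set 'rV[R]_d :=
  closure Om `\` (closure Om)°.

Definition MAC_domain (Om : set 'rV[R]_d) : Prop :=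
  [/\ open Om, connected Om, bounded_set Om &
      exists2 s : seq box, (forall b, b \in s -> nondegenerate b) &
        closure Om = \bigcup_(b in [set` s]) box_set b].

End Space.

Arguments box : clear implicits.
Arguments face : clear implicits.

Section Mesh.
Context {R : realType} {d : nat}.
Variable M : {fset box R d}.

(* The last condition says that there are no hanging nodes: two cells that
   meet do so along a common face, edge or vertex. *)
Record MAC_mesh (Om : set 'rV[R]_d) : Prop := {
  mesh_nondegenerate : forall K, K \in M -> nondegenerate K;
  mesh_cover : closure Om = \bigcup_(K in [set` M]) box_set K;
  mesh_disjoint : forall K L, K \in M -> L \in M -> K <> L ->
    (box_set K)° `&` (box_set L)° = set0;
  mesh_conforming : forall K L, K \in M -> L \in M ->
    box_set K `&` box_set L !=set0 ->
    forall i, [\/ K.1 0 i = L.1 0 i /\ K.2 0 i = L.2 0 i,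
                  K.2 0 i = L.1 0 i | L.2 0 i = K.1 0 i] }.

Definition E : {fset face R d} := (\bigcup_(K <- M) faces K)%fset.

Definition E_int : {fset face R d} :=
  [fset f in E | [exists K : M, [exists L : M,
     [&& val K != val L, f \in faces (val K) & f \in faces (val L)]]]]%fset.

Definition E_ext : {fset face R d} := (E `\` E_int)%fset.

(* The cell lying below (s = false) or above (s = true) the face f. Where
   there is none, the flat box f.2 stands for it, so that D_f below is one
   half of a cell when f is external. For f = K|L we take K := cell f false
   and L := cell f true. *)
Definition cell (f : face R d) (s : bool) : box R d :=
  xget f.2 [set K | K \in M /\ f = face_of K f.1 (~~ s)].

Definition mid (b : box R d) (i : 'I_d) : R := (b.1 0 i + b.2 0 i) / 2.

(* D_f, the union of the halves of the cells on both sides of f *)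
Definition dual_cell (f : face R d) : box R d :=
  (set_coord f.2.1 f.1 (mid (cell f false) f.1),
   set_coord f.2.2 f.1 (mid (cell f true) f.1)).

Definition dual_avg (q : box R d -> R) (f : face R d) : R :=
  let K := cell f false in let L := cell f true in
  (vol K / 2 * q K + vol L / 2 * q L) / vol (dual_cell f).

Definition grad (q : box R d -> R) (f : face R d) : R :=
  let K := cell f false in let L := cell f true in
  area f / vol (dual_cell f) * (q L - q K) * normal f K.

(* The face f' such that e, a face of D_f, separates D_f from D_f'. At a
   re-entrant corner of the domain the face of D_f' is only one half of e
   (and f' is external), whence the inclusion. *)
Definition dual_neighbour (f e : face R d) : face R d :=
  let s := is_upper (dual_cell f) e in
  xget f [set f' | [/\ f' \in E, f'.1 = f.1, f' <> f &
    box_set (face_of (dual_cell f') e.1 (~~ s)).2 `<=` box_set e.2]].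

End Mesh.

Section Thermo.
Context {R : realType}.
Variable gamma : R.

Definition pressure (a : R) : R := a `^ gamma.

Definition h (a : R) : R := a `^ gamma / (gamma - 1).

Definition Pi (a b : R) : R := h a - h b - derive1 h b * (a - b).

Definition interface_value (a b : R) : R :=
  xget 0 [set r | if a == b then r = a else
    Num.min a b <= r <= Num.max a b /\
    a `^ gamma - b `^ gamma = r * (derive1 h a - derive1 h b)].

Definition negpart (x : R) : R := (`|x| - x) / 2.

Context {d : nat}.
Variables (C : R) (phi : 'rV[R]_d -> R).

Definition rho_hyd (x : 'rV[R]_d) : R :=
  ((gamma - 1) / gamma * (C - phi x)) `^ (1 / (gamma - 1)).

(* The sign condition is not redundant: the library's powR takes the value 1
   at negative bases. *)
Definition hydrostatic_data (Om : set 'rV[R]_d) (m0 : R) : Prop :=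
  [/\ exists U, [/\ open U, closure Om `<=` U & smooth U phi],
      exists2 c, 0 < c &
        forall x, Om x -> 0 <= C - phi x /\ c <= rho_hyd x &
      integral_rV Om rho_hyd = m0%:E].

Definition rho_hyd_cell (K : box R d) : R :=
  fine (integral_rV (box_set K) rho_hyd) / vol K.

Definition phi_cell (K : box R d) : R := C - derive1 h (rho_hyd_cell K).

End Thermo.

(* Discrete densities are functions of the cell and discrete velocities
   functions of the face; only their values on M and on E matter. *)
Section Scheme.
Context {R : realType} {d : nat}.
Variables (Om : set 'rV[R]_d) (M : {fset box R d}).
Variables (gamma eps dt : R) (eta : face R d -> R) (phiM : box R d -> R).

Definition velocity_space (u : face R d -> R) : Prop :=
  forall f, f \in E_ext M -> u f = 0.

Definition density_positive (rho : box R d -> R) : Prop :=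
  forall K, K \in M -> 0 < rho K.

Definition rho_face (rho : box R d -> R) (f : face R d) : R :=
  interface_value gamma (rho (cell M f false)) (rho (cell M f true)).

Definition force (rho : box R d -> R) (f : face R d) : R :=
  grad M (pressure gamma \o rho) f + rho_face rho f * grad M phiM f.

Definition delta_u (rho : box R d -> R) (f : face R d) : R :=
  if f \in E_int M then eta f * dt / eps ^+ 2 * force rho f else 0.

Definition flux (rho : box R d -> R) (u : face R d -> R)
    (f : face R d) (K : box R d) : R :=
  if f \in E_int M then
    area f * rho_face rho f * (u f - delta_u rho f) * normal f K
  else 0.

(* F_(e, f), for f = K|L internal and e a face of D_f. In the second case Q is
   the one of K, L containing e, and face_of Q f.1 s its face opposite to f;
   in the third one, e is made of halves of the faces of K and L lying on
   the same side as e. *)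
Definition dual_flux (rho : box R d -> R) (u : face R d -> R)
    (f e : face R d) : R :=
  let s := is_upper (dual_cell M f) e in
  let F := flux rho u in
  if `[< box_set e.2 `<=` outer_boundary Om >] then 0
  else if e.1 == f.1 then
    let Q := cell M f s in
    (F (face_of Q f.1 s) Q - F f Q) / 2
  else
    let K := cell M f false in let L := cell M f true in
    (F (face_of K e.1 s) K + F (face_of L e.1 s) L) / 2.

Definition u_up (rho : box R d -> R) (u : face R d -> R) (f e : face R d) : R :=
  if 0 <= dual_flux rho u f e then u f else u (dual_neighbour M f e).

Definition mass_eq (rho0 : box R d -> R) (u0 : face R d -> R)
    (rho1 : box R d -> R) : Prop :=
  forall K, K \in M ->
    (rho1 K - rho0 K) / dt
    + 1 / vol K * (\sum_(f <- faces K) flux rho1 u0 f K) = 0.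

Definition momentum_eq (rho0 : box R d -> R) (u0 : face R d -> R)
    (rho1 : box R d -> R) (u1 : face R d -> R) : Prop :=
  forall f, f \in E_int M ->
    let D := dual_cell M f in
    (dual_avg M rho1 f * u1 f - dual_avg M rho0 f * u0 f) / dt
    + 1 / vol D * (\sum_(e <- faces D) dual_flux rho1 u0 f e * u_up rho1 u0 f e)
    + 1 / eps ^+ 2 * grad M (pressure gamma \o rho1) f
    = - (1 / eps ^+ 2 * rho_face rho1 f * grad M phiM f).

Definition solution (rho0 : box R d -> R) (u0 : face R d -> R)
    (rho1 : box R d -> R) (u1 : face R d -> R) : Prop :=
  [/\ density_positive rho1, velocity_space u1,
      mass_eq rho0 u0 rho1 & momentum_eq rho0 u0 rho1 u1].

End Scheme.

(* Main.v *)
Require Import Defs.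
From mathcomp Require Import all_boot all_order all_algebra finmap.
From mathcomp Require Import all_classical all_reals all_analysis.
From mathcomp Require Import ring lra.
Import Order.TTheory GRing.Theory Num.Theory.
Import numFieldNormedType.Exports.
Local Open Scope classical_set_scope.
Local Open Scope ring_scope.

(** The scheme is arranged so that each of the two discrete balances behind the
    energy identity holds up to signed remainders, and so that the work of the
    force [G = grad p + rho grad phi] appears in both with opposite signs.

    Testing the mass balance of a cell with [h'(rho1) - h'(rho_hyd)] and using
    that [h] lies above its tangents bounds the increment of the potential
    energy by the work of the corrected velocity [u0 - delta_u] against [G]
    ([potential_balance]). The choice of the interface density is what turns
    [rho_f (h'(rho_L) - h'(rho_K))] into the pressure difference, hence the
    mass fluxes into that work ([interface_valueP], [flux_work]).

    Testing the momentum balance of a dual cell with [u0], and adding the mass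
    balance of the dual cell times [u0 ^ 2 / 2], gives a kinetic balance in which
    the old velocity does the work: the explicit treatment leaves the
    anti-dissipative remainder [rho (u1 - u0) ^ 2 / 2] and upwinding leaves the
    dissipative one, the sum of [F^- (u' - u0) ^ 2 / 2] over the dual faces. The
    momentum balance writes [u1 - u0] as an upwind part and a force part. Under
    the time-step restriction the square of the former is absorbed by the
    upwind dissipation, and under the condition on [eta] the square of the
    latter by the work of [delta_u] ([local_kinetic_balance]).

    Adding up the faces leaves the transport term, the sum of the [F u_up ^ 2 / 2].
    Dual fluxes are opposite on the two sides of a dual face and both sides
    agree on the upwind value, so the term is nonnegative: it telescopes except
    where the neighbour is external, and there the upwind value is zero when
    mass enters ([dual_transport_ge0]).

    The geometric work is to recover the grid structure from conformity alone:
    two cells that meet have, in each direction, the same interval or abutting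
    ones ([meeting_cells]). It yields that a face determines its cells, that the
    neighbour of a dual cell across one of its faces is unique
    ([across_unique]), that it exists wherever the flux is nonzero
    ([across_exists]), and that the fluxes of a dual cell add up to the mean of
    those of its two cells ([dual_flux_sum]), for which one has to see that
    dual faces contained in the boundary carry no flux ([flux_boundary]). *)

(** * Convexity of the internal energy and the interface density *)

Section Thermo.
Local Set Implicit Arguments.
Local Unset Strict Implicit.
Context {R : realType} (gamma : R).
Hypothesis gamma_gt1 : 1 < gamma.

Let g0 : 0 < gamma. Proof. exact: lt_trans gamma_gt1. Qed.
Let g1 : 0 < gamma - 1. Proof. by rewrite subr_gt0. Qed.

Lemma derive1_h (a : R) : 0 < a ->
  derive1 (h gamma) a = gamma / (gamma - 1) * a `^ (gamma - 1).
Proof.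
move=> a0; rewrite derive1E.
have H := is_derive1_powR gamma a0.
have -> : h gamma = (gamma - 1)^-1 \*: (fun y : R => y `^ gamma).
  by apply/funext => y; rewrite /h /= mulrC.
rewrite deriveZ//= derive_val; rewrite /GRing.scale/=; ring.
Qed.

Lemma powR_pred (a : R) : 0 < a -> a `^ gamma = a * a `^ (gamma - 1).
Proof.
move=> a0; rewrite -[X in _ = X * _]powRr1 ?ltW// -powRD.
  by rewrite addrC subrK.
by rewrite (gt_eqF a0) implybT.
Qed.

(** Young's inequality for [x] and [y ^ (gamma - 1)]: up to rearrangement, the
    graph of the [gamma]-th power lies above its tangent at [y]. *)
Lemma powR_tangent (x y : R) : 0 < x -> 0 < y ->
  gamma * x * y `^ (gamma - 1) <= x `^ gamma + (gamma - 1) * y `^ gamma.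
Proof.
move=> x0 y0; set q := gamma / (gamma - 1).
have q0 : 0 < q by rewrite divr_gt0.
have := conjugate_powR (ltW x0) (powR_ge0 y (gamma - 1)) g0 q0.
rewrite -powRrM {1}/q -[(gamma - 1) * q]mulrC divfK ?gt_eqF// => /(_ _)/wrap[].
  by rewrite /q; field; rewrite !gt_eqF.
rewrite -(ler_pM2l g0); congr (_ <= _); first by rewrite mulrA.
by rewrite /q; field; rewrite !gt_eqF.
Qed.

Lemma h_tangent (a b : R) : 0 < a -> 0 < b ->
  h gamma b + derive1 (h gamma) b * (a - b) <= h gamma a.
Proof.
move=> a0 b0; rewrite derive1_h// /h.
rewrite -(ler_pM2r g1) divfK ?gt_eqF//.
have := powR_tangent a0 b0; have := powR_pred b0.
set B := b `^ gamma; set A := a `^ gamma; set B' := b `^ _ => -> H.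
have -> : (b * B' / (gamma - 1) + gamma / (gamma - 1) * B' * (a - b)) * (gamma - 1)
  = b * B' + gamma * B' * (a - b) by field; rewrite gt_eqF.
lra.
Qed.

(** [Pi _ b] differs from [h] by an affine function, so this is the tangent
    inequality of [h] at [a1]. *)
Lemma Pi_diff_le (a0 a1 b : R) : 0 < a0 -> 0 < a1 ->
  Pi gamma a1 b - Pi gamma a0 b
  <= (derive1 (h gamma) a1 - derive1 (h gamma) b) * (a1 - a0).
Proof. by move=> p0 p1; have := h_tangent p0 p1; rewrite /Pi; lra. Qed.

(** The quotient that defines the interface value does lie between [a] and [b]:
    its two bounds are the tangent inequality at either end. Hence the set from
    which the interface value is chosen is inhabited. *)
Lemma interface_valueP (a b : R) : 0 < a -> 0 < b ->
  a `^ gamma - b `^ gamma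
  = interface_value gamma a b * (derive1 (h gamma) a - derive1 (h gamma) b).
Proof.
move=> a0 b0; rewrite /interface_value; case: eqVneq => [->|ab].
  by rewrite !subrr mulr0.
set P := [set r | _].
suff : exists r, P r by move=> /(xgetPex 0)[].
wlog ba : a b a0 b0 ab @P / b < a.
  move=> W; have [ba|ba|ba] := ltgtP b a; first exact: W.
    have [r [rab re]] := W b a b0 a0 (contra_neq (@esym _ _ _) ab) ba.
    by exists r; split; [rewrite minC maxC|lra].
  by rewrite ba eqxx in ab.
rewrite /P/= !derive1_h//.
have ta := powR_tangent a0 b0; have tb := powR_tangent b0 a0.
have ltd : b `^ (gamma - 1) < a `^ (gamma - 1).
  by apply: gt0_ltr_powR; rewrite ?nnegrE ?ltW.
move: ta tb; rewrite !powR_pred//; move: ltd.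
set A := a `^ _; set B := b `^ _ => ltd ta tb.
have dAB : 0 < A - B by lra.
exists ((gamma - 1) / gamma * ((a * A - b * B) / (A - B))).
rewrite (min_r (ltW ba)) (max_l (ltW ba)); split; last first.
  by field; rewrite !gt_eqF.
rewrite mulf_div ler_pdivlMr ?mulr_gt0// ler_pdivrMr ?mulr_gt0//.
apply/andP; split; nra.
Qed.

End Thermo.

(** * Kinetic energy balance on one dual cell *)

Section Local.
Local Set Implicit Arguments.
Local Unset Strict Implicit.
Context {R : realType}.
Local Notation np := (@negpart R).

Lemma negpart_ge0 (x : R) : 0 <= np x.
Proof. rewrite /negpart divr_ge0// subr_ge0; exact: ler_norm. Qed.

Lemma negpartE (x : R) : np x = if 0 <= x then 0 else - x.
Proof.
rewrite /negpart; case: leP => x0.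
  by rewrite ger0_norm// subrr mul0r.
by rewrite ltr0_norm//; lra.
Qed.

(** Cauchy-Schwarz, in the form which the time-step restriction allows: expand
    the sum of the [m i * (x i - y) ^+ 2] at [y = 2 * c * S1], with [S1] the
    weighted sum. *)
Lemma sqr_weighted_sum_le (I : Type) (r : seq I) (m x : I -> R) (c : R) :
  (forall i, 0 <= m i) -> 0 <= c -> c * (\sum_(i <- r) m i) <= 1 / 2 ->
  2 * c * (\sum_(i <- r) m i * x i) ^+ 2 <= \sum_(i <- r) m i * x i ^+ 2.
Proof.
move=> m0 c0; set S0 := \sum_(i <- r) m i; set S1 := \sum_(i <- r) m i * x i.
set S2 := (X in _ -> _ <= X) => cS.
have : 0 <= \sum_(i <- r) m i * (x i - 2 * c * S1) ^+ 2.
  by apply: sumr_ge0 => i _; rewrite mulr_ge0 ?sqr_ge0.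
have -> : \sum_(i <- r) m i * (x i - 2 * c * S1) ^+ 2
    = S2 - 4 * c * S1 * S1 + 4 * c ^+ 2 * S1 ^+ 2 * S0.
  rewrite (eq_bigr (fun i => m i * x i ^+ 2 - 4 * c * S1 * (m i * x i)
                             + 4 * c ^+ 2 * S1 ^+ 2 * m i)).
    by rewrite big_split sumrB -!mulr_sumr.
  by move=> i _; ring.
have H : c * S1 ^+ 2 * (c * S0) <= c * S1 ^+ 2 * (1/2).
  by rewrite ler_wpM2l// mulr_ge0 ?sqr_ge0.
nra.
Qed.

(** The momentum balance gives [u1 - u0] as [c * S1 - dt / r1 * g], an upwind part
    and a force part. In the square of this sum, the former is absorbed by the
    upwind dissipation [S2] through [sqr_weighted_sum_le], the latter by the
    stabilisation through [1 / r1 <= eta]; the factors [2] from splitting the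
    square account for the bound [1 / 2] in the time-step restriction. *)
Lemma local_kinetic_balance (I : Type) (r : seq I)
    (D dt eps eta r0 r1 u0 u1 G : R) (F v : I -> R) :
  0 < D -> 0 < dt -> 0 < eps -> 0 < r1 ->
  D * (r1 - r0) / dt + \sum_(i <- r) F i = 0 ->
  (r1 * u1 - r0 * u0) / dt
    + 1 / D * (\sum_(i <- r) F i * (if 0 <= F i then u0 else v i))
    + 1 / eps ^+ 2 * G = 0 ->
  dt / D * (\sum_(i <- r) np (F i) / r1) <= 1 / 2 ->
  1 / r1 <= eta ->
  D * (1 / 2 * r1 * u1 ^+ 2) - D * (1 / 2 * r0 * u0 ^+ 2)
  + dt * (D / eps ^+ 2 * (u0 - eta * dt / eps ^+ 2 * G) * G)
  + dt / 2 * (\sum_(i <- r) F i * (if 0 <= F i then u0 else v i) ^+ 2) <= 0.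
Proof.
move=> D0 dt0 eps0 r10 mass mom; rewrite -mulr_suml => cfl etar.
set up := fun i => if 0 <= F i then u0 else v i.
pose x i := up i - u0; pose m i := np (F i).
set T := \sum_(i <- r) F i in mass.
set U := \sum_(i <- r) _ in mom.
set V := \sum_(i <- r) F i * _ ^+ 2.
set S0 := \sum_(i <- r) np (F i) in cfl.
pose S1 := \sum_(i <- r) m i * x i; pose S2 := \sum_(i <- r) m i * x i ^+ 2.
(* [u0 * up - u0 ^ 2 / 2 = up ^ 2 / 2 - (up - u0) ^ 2 / 2], and [F x = - F^- x]
   because the upwind value is [u0] itself where [F] is nonnegative *)
have UE : U = u0 * T - S1.
  rewrite /U /T /S1 mulr_sumr -sumrB; apply: eq_bigr => i _.
  by rewrite /x /up /m negpartE; case: ifP => _; ring.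
have VE : V = 2 * u0 * U - u0 ^+ 2 * T - S2.
  rewrite /V /U /T /S2 !mulr_sumr -!sumrB; apply: eq_bigr => i _.
  by rewrite /x /up /m negpartE; case: ifP => _; ring.
pose c := dt / (D * r1).
have c0 : 0 < c by rewrite divr_gt0// mulr_gt0.
have cS : c * S0 <= 1 / 2.
  have -> : c * S0 = dt / D * (S0 / r1) by rewrite /c; field; rewrite !gt_eqF.
  exact: cfl.
have WS := sqr_weighted_sum_le (r := r) x (fun i => negpart_ge0 (F i)) (ltW c0) cS.
rewrite -/S1 -/S2 in WS.
pose g := 1 / eps ^+ 2 * G.
have r0E : r0 = r1 + dt / D * T.
  have : (r1 - r0) = - (dt / D * T).
    have -> : T = - (D * (r1 - r0) / dt) by lra.
    by field; rewrite !gt_eqF.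
  lra.
have u1E : u1 = u0 + c * S1 - dt / r1 * g.
  have e1 : r1 * u1 = r0 * u0 - dt * (1 / D * U + g).
    have -> : 1 / D * U + g = - ((r1 * u1 - r0 * u0) / dt) by rewrite /g; lra.
    by field; rewrite gt_eqF.
  apply: (mulfI (lt0r_neq0 r10)); rewrite e1 UE r0E /c.
  by field; rewrite !gt_eqF.
have gG : D / eps ^+ 2 * (u0 - eta * dt / eps ^+ 2 * G) * G
    = D * (u0 - eta * dt * g) * g.
  by rewrite /g; field; rewrite gt_eqF.
rewrite gG.
set L := (X in X <= 0).
(* the exact balance: explicit remainder, upwind dissipation, stabilisation *)
have -> : L = 1 / 2 * D * r1 * (c * S1 - dt / r1 * g) ^+ 2 - dt / 2 * S2
    - D * dt ^+ 2 * g ^+ 2 * eta.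
  by rewrite /L VE u1E UE r0E /c; field; rewrite !gt_eqF.
have sq : 1 / 2 * D * r1 * (c * S1 - dt / r1 * g) ^+ 2
    <= D * r1 * ((c * S1) ^+ 2 + (dt / r1 * g) ^+ 2).
  have : 0 <= D * r1 * (c * S1 + dt / r1 * g) ^+ 2.
    by rewrite mulr_ge0 ?sqr_ge0// mulr_ge0 ?ltW.
  nra.
have eS : D * r1 * (c * S1) ^+ 2 <= dt / 2 * S2.
  have -> : D * r1 * (c * S1) ^+ 2 = dt / 2 * (2 * c * S1 ^+ 2).
    by rewrite /c; field; rewrite !gt_eqF.
  by apply: ler_wpM2l WS; rewrite divr_ge0 ?ltW.
have eg : D * r1 * (dt / r1 * g) ^+ 2 <= D * dt ^+ 2 * g ^+ 2 * eta.
  have -> : D * r1 * (dt / r1 * g) ^+ 2 = D * dt ^+ 2 * g ^+ 2 * (1 / r1).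
    by field; rewrite gt_eqF.
  by apply: ler_wpM2l etar; rewrite mulr_ge0 ?sqr_ge0// mulr_ge0 ?sqr_ge0 ?ltW.
by lra.
Qed.
End Local.

(** * Boxes and their faces *)

Section Boxes.
Local Set Implicit Arguments.
Local Unset Strict Implicit.
Context {R : realType} {d : nat}.
Implicit Types (P Q b c : box R d) (i j k : 'I_d) (s t : bool).

Lemma face_loE b i s k : (face_of b i s).2.1 0 k =
  if k == i then (if s then b.2 else b.1) 0 i else b.1 0 k.
Proof. by rewrite mxE. Qed.

Lemma face_hiE b i s k : (face_of b i s).2.2 0 k =
  if k == i then (if s then b.2 else b.1) 0 i else b.2 0 k.
Proof. by rewrite mxE. Qed.

Lemma box_eq P Q : (forall k, P.1 0 k = Q.1 0 k /\ P.2 0 k = Q.2 0 k) -> P = Q.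
Proof.
move: P Q => [p1 p2] [q1 q2]/= e.
by congr pair; apply/rowP => k; have [] := e k.
Qed.

(** Faces are compared coordinatewise, so that statements about them become
    linear arithmetic on the corners of the boxes. *)
Lemma face_of_eqP P Q i s t :
  face_of P i s = face_of Q i t <->
  (if s then P.2 else P.1) 0 i = (if t then Q.2 else Q.1) 0 i /\
  forall k, k != i -> P.1 0 k = Q.1 0 k /\ P.2 0 k = Q.2 0 k.
Proof.
split=> [e|[ei ek]].
  have lo k : (face_of P i s).2.1 0 k = (face_of Q i t).2.1 0 k by rewrite e.
  have hi k : (face_of P i s).2.2 0 k = (face_of Q i t).2.2 0 k by rewrite e.
  split=> [|k /negPf ki]; first by have := lo i; rewrite !face_loE eqxx.
  by have := lo k; have := hi k; rewrite !face_hiE !face_loE ki => -> ->.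
congr pair; apply: box_eq => k; rewrite !face_loE !face_hiE.
by case: eqVneq => [_|ki]; rewrite ?ei//; have [-> ->] := ek k ki.
Qed.

Lemma is_upper_face b i s : b.1 0 i < b.2 0 i -> is_upper b (face_of b i s) = s.
Proof.
move=> bi; case: s; first by rewrite /is_upper/= eqxx.
apply/negbTE/eqP => /face_of_eqP[e _]; lra.
Qed.

Lemma normal_face b i s : b.1 0 i < b.2 0 i ->
  normal (face_of b i s) b = if s then 1 else -1.
Proof. by move=> bi; rewrite /normal is_upper_face. Qed.

Lemma face_of_inj b : Defs.nondegenerate b ->
  injective (fun q : 'I_d * bool => face_of b q.1 q.2).
Proof.
move=> nb [i s] [j t] /= e.
have ij : i = j by case: e.
subst j; congr pair.
by rewrite -(is_upper_face s (nb i)) e is_upper_face.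
Qed.

Lemma big_faces b (g : face R d -> R) : Defs.nondegenerate b ->
  \sum_(e <- faces b) g e = \sum_(q : 'I_d * bool) g (face_of b q.1 q.2).
Proof.
move=> nb; rewrite /faces big_imfset/=; last by move=> p q _ _; exact: face_of_inj.
by rewrite big_enum.
Qed.

Lemma mem_faces b f : (f \in faces b) = [exists q, f == face_of b q.1 q.2].
Proof.
by apply/imfsetP/existsP => [[q _ ->]|[q /eqP->]]; exists q.
Qed.

Lemma box_subset b c : (forall k, b.1 0 k <= b.2 0 k) -> box_set b `<=` box_set c ->
  forall k, c.1 0 k <= b.1 0 k /\ b.2 0 k <= c.2 0 k.
Proof.
move=> bb bc k.
have b1 : box_set b b.1 by move=> i; rewrite bb lexx.
have b2 : box_set b b.2 by move=> i; rewrite bb lexx.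
by have /andP[-> _] := bc _ b1 k; have /andP[_ ->] := bc _ b2 k.
Qed.

End Boxes.

(** * Cells and dual cells of a conforming grid *)

Section Mesh.
Local Set Implicit Arguments.
Local Unset Strict Implicit.
Context {R : realType} {d : nat} (Om : set 'rV[R]_d) (M : {fset box R d}).
Hypothesis hM : MAC_mesh M Om.
Implicit Types (K L P Q : box R d) (i j k : 'I_d) (s t : bool) (f : face R d).

Let ndeg K k : K \in M -> K.1 0 k < K.2 0 k.
Proof. by move=> KM; exact: mesh_nondegenerate hM _ KM k. Qed.

(** Conformity, in the form used throughout: a common point [x] is exhibited,
    and the alternative that fits the other constraints on [K] and [L] is found
    by linear arithmetic. *)
Lemma meeting_cells K L x k : K \in M -> L \in M -> box_set K x -> box_set L x ->
  [\/ K.1 0 k = L.1 0 k /\ K.2 0 k = L.2 0 k,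
      K.2 0 k = L.1 0 k | L.2 0 k = K.1 0 k].
Proof. by move=> KM LM Kx Lx; apply: (mesh_conforming hM) => //; exists x. Qed.

(** Two cells on the same side of a face overlap near it. *)
Lemma cell_of_face_unique K L i s : K \in M -> L \in M ->
  face_of K i s = face_of L i s -> K = L.
Proof.
move=> KM LM /face_of_eqP[ei ek].
pose x := \row_k if k == i then (if s then K.2 else K.1) 0 i else K.1 0 k.
have Kx : box_set K x.
  by move=> k; rewrite mxE; have := ndeg k KM; case: eqP => [->|_]; case: s {ei x}; lra.
have Lx : box_set L x.
  move=> k; rewrite mxE; have := ndeg k LM; have := ndeg k KM.
  by case: eqVneq => [->|/ek[]]; case: s ei {x Kx} => /=; lra.
apply: box_eq => k; have [->|/ek//] := eqVneq k i.
have := meeting_cells i KM LM Kx Lx; have := ndeg i LM; have := ndeg i KM.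
by move=> ? ? [[]|?|?] //; move: ei; case: s {x Kx Lx} => /=; lra.
Qed.

(** By uniqueness, the cell chosen on each side of a face is the expected one. *)
Lemma cell_face K i s : K \in M -> cell M (face_of K i s) (~~ s) = K.
Proof.
move=> KM; apply: xget_unique => [|L []]/=; rewrite negbK//.
by move=> LM e; apply/esym/(cell_of_face_unique (i := i) (s := s)).
Qed.

Lemma EP f : reflect (exists K i s, K \in M /\ f = face_of K i s) (f \in E M).
Proof.
rewrite /E; apply: (iffP (bigfcupP _ _ _ _)) => [[K /andP[KM _]]|[K [i [s [KM ->]]]]].
  by rewrite mem_faces => /existsP[[i s] /eqP ->]; exists K, i, s.
by exists K; rewrite ?KM// mem_faces; apply/existsP; exists (i, s).
Qed.

(** An internal face orthogonal to [e_i] is handled through its two cells: the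
    upper face of the lower one [K] is the lower face of the upper one [L]. *)
Definition stacked i K L :=
  [/\ K \in M, L \in M & face_of K i true = face_of L i false].

Lemma stacked_coord i K L : stacked i K L -> K.2 0 i = L.1 0 i /\
  forall k, k != i -> K.1 0 k = L.1 0 k /\ K.2 0 k = L.2 0 k.
Proof. by case=> _ _ /face_of_eqP. Qed.

Lemma E_intP f :
  reflect (exists i K L, stacked i K L /\ f = face_of K i true) (f \in E_int M).
Proof.
rewrite !inE; apply: (iffP andP) => [[_ /existsP[K /existsP[L]]]|].
  case/and3P; rewrite !mem_faces => KL /existsP[[i s]/= /eqP fK].
  case/existsP => [[j t]/= /eqP fL].
  have ij : i = j by rewrite fK in fL; case: fL.
  subst j; have KM := valP K; have LM := valP L.
  have st : s != t.
    apply/eqP => st; subst t; move/eqP: KL; apply.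
    by apply: (cell_of_face_unique (i := i) (s := s)) => //; rewrite -fK.
  case: s t st fK fL => [] [] // _ fK fL.
    by exists i, (val K), (val L); split => //; split => //; rewrite -fK.
  by exists i, (val L), (val K); split => //; split => //; rewrite -fK.
move=> [i [K [L [[KM LM KL] ->]]]].
split; first by apply/EP; exists K, i, true.
apply/existsP; exists [` KM]%fset; apply/existsP; exists [` LM]%fset.
apply/and3P; split; rewrite /= ?mem_faces; last 2 first.
- by apply/existsP; exists (i, true).
- by apply/existsP; exists (i, false); rewrite KL.
apply/eqP => e; subst L; move/face_of_eqP : KL => [/= e _].
by have := ndeg i KM; lra.
Qed.

Lemma cell_stacked i K L : stacked i K L ->
  cell M (face_of K i true) false = K /\ cell M (face_of K i true) true = L.
Proof.
move=> [KM LM e]; split; first exact: (cell_face i true).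
by rewrite e; exact: (cell_face i false).
Qed.

Lemma dual_loE P i t k : (dual_cell M (face_of P i t)).1 0 k =
  if k == i then mid (cell M (face_of P i t) false) i else P.1 0 k.
Proof. by rewrite 2!mxE; case: eqP. Qed.

Lemma dual_hiE P i t k : (dual_cell M (face_of P i t)).2 0 k =
  if k == i then mid (cell M (face_of P i t) true) i else P.2 0 k.
Proof. by rewrite 2!mxE; case: eqP. Qed.

Lemma dual_endE P i t s k :
  (if s then (dual_cell M (face_of P i t)).2
   else (dual_cell M (face_of P i t)).1) 0 k =
  if k == i then mid (cell M (face_of P i t) s) i
  else (if s then P.2 else P.1) 0 k.
Proof. by case: s; [exact: dual_hiE|exact: dual_loE]. Qed.

Lemma dual_stackedE i K L k : stacked i K L ->
  (dual_cell M (face_of K i true)).1 0 k = (if k == i then mid K i else K.1 0 k) /\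
  (dual_cell M (face_of K i true)).2 0 k = (if k == i then mid L i else K.2 0 k).
Proof.
by move=> KL; rewrite dual_loE dual_hiE; have [-> ->] := cell_stacked KL.
Qed.

Lemma dual_stacked_ndeg i K L : stacked i K L ->
  Defs.nondegenerate (dual_cell M (face_of K i true)).
Proof.
move=> KL k; have [-> ->] := dual_stackedE k KL.
have [KM LM _] := KL; have [e _] := stacked_coord KL.
have := ndeg i KM; have := ndeg i LM; have := ndeg k KM; rewrite /mid.
by case: eqVneq => [->|_]; lra.
Qed.

Lemma cell_cases f s : cell M f s = f.2 \/
  cell M f s \in M /\ f = face_of (cell M f s) f.1 (~~ s).
Proof.
have [ex|nex] := pselect (exists K, K \in M /\ f = face_of K f.1 (~~ s)).
  by right; exact: (xgetPex f.2 ex).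
by left; apply: xgetPN => K KP; apply: nex; exists K.
Qed.

Lemma mid_flat P i t :
  mid (face_of P i t).2 i = (if t then P.2 else P.1) 0 i.
Proof. by rewrite /mid !mxE eqxx; lra. Qed.

(** When a cell is missing on one side, the flat box of the face stands for it,
    and its midpoint is the face itself. So the dual cell of any face, external
    or not, contains the coordinate of that face. *)
Lemma mid_cell P i t : P \in M ->
  mid (cell M (face_of P i t) false) i <= (if t then P.2 else P.1) 0 i
    <= mid (cell M (face_of P i t) true) i.
Proof.
move=> PM; set f := face_of P i t.
have endE K s : f = face_of K i s ->
    (if t then P.2 else P.1) 0 i = (if s then K.2 else K.1) 0 i.
  by case/face_of_eqP.
apply/andP; split.
  have [->|[KM /endE/= ->]] := cell_cases f false; first by rewrite mid_flat.
  by rewrite /mid; have := ndeg i KM; lra.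
have [->|[KM /endE/= ->]] := cell_cases f true; first by rewrite mid_flat.
by rewrite /mid; have := ndeg i KM; lra.
Qed.

(** * Neighbours across a dual face *)

Definition dual_face f j s := face_of (dual_cell M f) j s.

(** The property from which the neighbour of the dual cell of [f] across its face
    [(j, s)] is chosen. *)
Definition across f j s f' :=
  [/\ f' \in E M, f'.1 = f.1, f' <> f &
      box_set (dual_face f' j (~~ s)).2 `<=` box_set (dual_face f j s).2].

(** Inclusion of the facing dual faces, in coordinates. *)
Lemma across_coord f j s f' i P t : P \in M -> f' = face_of P i t ->
  across f j s f' ->
  [/\ f.1 = i,
      (if ~~ s then (dual_cell M f').2 else (dual_cell M f').1) 0 j =
        (if s then (dual_cell M f).2 else (dual_cell M f).1) 0 j &
      forall k, k != j ->
        (dual_cell M f).1 0 k <= (dual_cell M f').1 0 k /\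
        (dual_cell M f').2 0 k <= (dual_cell M f).2 0 k].
Proof.
move=> PM -> [_ e _] sub.
set D' := dual_cell M (face_of P i t).
have D'le k : D'.1 0 k <= D'.2 0 k.
  rewrite dual_loE dual_hiE; have := ndeg k PM; have := mid_cell i t PM.
  by case: eqVneq => [->|_]; lra.
have e'le k : (dual_face (face_of P i t) j (~~ s)).2.1 0 k
    <= (dual_face (face_of P i t) j (~~ s)).2.2 0 k.
  by rewrite face_loE face_hiE; case: eqP.
have inc := box_subset e'le sub.
split; first exact: esym e.
  have := inc j; rewrite !face_loE !face_hiE eqxx => -[? ?].
  by apply/eqP; rewrite eq_le; apply/andP.
by move=> k /negPf kj; have := inc k; rewrite !face_loE !face_hiE kj.
Qed.

(** Each cell [P] of a lateral neighbour [f'] is adjacent, through a face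
    orthogonal to [e_j], to the cell of [f] lying on the same side. Indeed a
    point of [f'] on the dual face lies in [K] or [L], and conformity of [P]
    with that cell forces [f'] into the plane of [f], since the other planes
    allowed are beyond the midpoints which bound the dual cell. *)
Lemma across_lateral i K L j s f' t P : stacked i K L -> j != i ->
  across (face_of K i true) j s f' -> P \in M -> f' = face_of P i t ->
  face_of P j (~~ s) = face_of (if t then K else L) j s.
Proof.
move=> KL ji acr PM f'E; have [KM LM _] := KL.
have [_ ej inc] := across_coord PM f'E acr.
have [eKL eqKL] := stacked_coord KL.
have D'k k : k != i -> (dual_cell M f').1 0 k = P.1 0 k /\
    (dual_cell M f').2 0 k = P.2 0 k.
  by move=> /negPf ki; rewrite f'E dual_loE dual_hiE ki.
have D'i : (dual_cell M f').1 0 i <= (if t then P.2 else P.1) 0 i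
    <= (dual_cell M f').2 0 i.
  by rewrite f'E dual_loE dual_hiE eqxx; have := mid_cell i t PM.
set c' : R := (if t then P.2 else P.1) 0 i in D'i.
have {}ej : (if ~~ s then P.2 else P.1) 0 j = (if s then K.2 else K.1) 0 j.
  have [Dj1 Dj2] := dual_stackedE j KL; have [Pj1 Pj2] := D'k j ji.
  by move: ej; rewrite (negPf ji) in Dj1 Dj2; case: s {acr inc} => /=; lra.
have inc' k : k != i -> k != j -> K.1 0 k <= P.1 0 k /\ P.2 0 k <= K.2 0 k.
  move=> ki kj; have := inc k kj; have [-> ->] := D'k k ki.
  by have [-> ->] := dual_stackedE k KL; rewrite (negPf ki).
have inci : mid K i <= c' <= mid L i.
  have := inc i; rewrite eq_sym ji => /(_ isT).
  by have [-> ->] := dual_stackedE i KL; rewrite eqxx; lra.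
pose x := \row_k if k == i then c' else if k == j
  then (if ~~ s then P.2 else P.1) 0 j else P.1 0 k.
have Px : box_set P x.
  move=> k; rewrite mxE; have := ndeg k PM; rewrite /c'.
  by case: (eqVneq k i) => [->|_]; [case: (t)|case: (eqVneq k j) => [->|_]; [case: (s)|]]; lra.
have xk (Z : box R d) : (forall k, k != i -> K.1 0 k = Z.1 0 k /\ K.2 0 k = Z.2 0 k) ->
    Z.1 0 i <= c' <= Z.2 0 i -> box_set Z x.
  move=> eZ Zi k; rewrite mxE; have := ndeg k KM; have := ndeg k PM.
  case: (eqVneq k i) => [->//|ki]; case: (eqVneq k j) => [->|kj].
    by have [<- <-] := eZ j ji; rewrite ej; case: (s); lra.
  by have [<- <-] := eZ k ki; have := inc' k ki kj; lra.
have nP := ndeg i PM; have nK := ndeg i KM; have nL := ndeg i LM.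
rewrite /mid in inci.
(* [f'] lies in the plane of [f] *)
have c'E : c' = K.2 0 i.
  have [le|gt] := leP c' (K.2 0 i).
    have Kx : box_set K x by apply: xk => //; lra.
    by have := meeting_cells i PM KM Px Kx; rewrite /c' in le inci *;
      case: (t) le inci => le inci [[]|?|?]; lra.
  have Lx : box_set L x by apply: xk => //; lra.
  by have := meeting_cells i PM LM Px Lx; rewrite /c' in gt inci *;
    case: (t) gt inci => gt inci [[]|?|?]; lra.
set Z := if t then K else L.
have ZM : Z \in M by rewrite /Z; case: (t).
have eZ k : k != i -> K.1 0 k = Z.1 0 k /\ K.2 0 k = Z.2 0 k.
  by rewrite /Z; case: (t) => // /eqKL.
have Zx : box_set Z x by apply: xk => //; rewrite /Z; case: (t); lra.
have mZ k := meeting_cells k PM ZM Px Zx.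
apply/face_of_eqP; split.
  by have [e1 e2] := eZ j ji; rewrite ej; case: (s); lra.
move=> k kj; have [->|ki] := eqVneq k i.
  move: c'E (mZ i); rewrite /c' /Z.
  by case: (t) => c'E [[]|?|?] //; lra.
have nPk := ndeg k PM; have [i1 i2] := inc' k ki kj; have [e1 e2] := eZ k ki.
by case: (mZ k) => [[]|?|?] //; lra.
Qed.

(** In the direction of [f], the dual face is the middle section of a cell [Q] of
    [f]. A cell of the neighbour meets [Q] in the middle of its interval, so it
    is [Q] itself, and the neighbour is the face of [Q] opposite to [f]. *)
Lemma across_direct i K L s f' : stacked i K L ->
  across (face_of K i true) i s f' -> f' = face_of (if s then L else K) i s.
Proof.
move=> KL acr; have [KM LM KLe] := KL.
have [/EP[P0 [i0 [t0 [P0M f'E0]]]] f'i _ _] := acr.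
have e0 : i0 = i by move: f'i; rewrite f'E0.
subst i0; set Q := if s then L else K.
(* among the cells of [f'], one contains the midpoint that bounds its dual cell *)
have [P [t [PM f'E Pmid]]] : exists P t, [/\ P \in M, f' = face_of P i t &
    P.1 0 i <= mid (cell M f' (~~ s)) i <= P.2 0 i].
  have [cE|[cM cE]] := cell_cases f' (~~ s).
    exists P0, t0; split => //; rewrite cE f'E0 mid_flat.
    by have := ndeg i P0M; case: (t0); lra.
  exists (cell M f' (~~ s)), (~~ ~~ s); split => //; first by rewrite f'i in cE.
  by rewrite /mid; have := ndeg i cM; lra.
have [_ ei inc] := across_coord PM f'E acr.
have [eKL eqKL] := stacked_coord KL.
have QM : Q \in M by rewrite /Q; case: (s).
have mQ : mid (cell M f' (~~ s)) i = mid Q i.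
  move: ei; rewrite f'E !dual_endE !eqxx => ->.
  by have [c1 c2] := cell_stacked KL; rewrite /Q; case: (s); rewrite ?c1 ?c2.
have inc' k : k != i -> Q.1 0 k <= P.1 0 k /\ P.2 0 k <= Q.2 0 k.
  move=> ki; have := inc k ki; have [-> ->] := dual_stackedE k KL.
  rewrite f'E dual_loE dual_hiE (negPf ki) /Q.
  by case: (s) => //; have [<- <-] := eqKL k ki.
pose x := \row_k if k == i then mid Q i else P.1 0 k.
have Px : box_set P x.
  move=> k; rewrite mxE; case: (eqVneq k i) => [->|_]; first by rewrite -mQ.
  by have := ndeg k PM; lra.
have Qx : box_set Q x.
  move=> k; rewrite mxE; case: (eqVneq k i) => [->|ki].
    by rewrite /mid; have := ndeg i QM; lra.
  by have := inc' k ki; have := ndeg k PM; lra.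
have PQ : P = Q.
  apply: box_eq => k; have nP := ndeg k PM; have nQ := ndeg k QM.
  have := meeting_cells k PM QM Px Qx; have [ki|/inc' ?] := eqVneq k i.
    by subst k; rewrite mQ /mid in Pmid => -[[]|?|?] //; lra.
  by case=> [[]|?|?] //; lra.
rewrite f'E PQ; have [->//|st] := eqVneq t s.
case: acr => _ _ []; rewrite f'E PQ /Q.
by case: (s) (t) st => [] [].
Qed.

(** Four cells around an edge of the mesh: two cells next to [K] and [L], on the
    same side of both, are stacked as [K] and [L] are. *)
Lemma stacked_beside i K L j s P P' : stacked i K L -> j != i ->
  P \in M -> P' \in M -> face_of P j (~~ s) = face_of K j s ->
  face_of P' j (~~ s) = face_of L j s -> stacked i P P'.
Proof.
move=> KL ji PM P'M /face_of_eqP[ePj ePk] /face_of_eqP[eP'j eP'k].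
have [eKL eqKL] := stacked_coord KL; split => //; apply/face_of_eqP.
have ij : i != j by rewrite eq_sym.
have ei : P.2 0 i = P'.1 0 i.
  by have [_ ->] := ePk i ij; have [-> _] := eP'k i ij.
split=> // k ki; have [kj|kj] := eqVneq k j; last first.
  have [-> ->] := ePk k kj; have [-> ->] := eP'k k kj; exact: eqKL.
subst k; have [e1 e2] := eqKL j ji.
pose x := \row_k if k == i then P.2 0 i else if k == j
  then (if ~~ s then P.2 else P.1) 0 j else P.1 0 k.
have nP k := ndeg k PM; have nP' k := ndeg k P'M.
have Px : box_set P x.
  move=> k; rewrite mxE; have := nP k.
  by case: (eqVneq k i) => [->|_]; [|case: (eqVneq k j) => [->|_]; [case: (s)|]]; lra.
have P'x : box_set P' x.
  move=> k; rewrite mxE; have := nP' k; have := nP k.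
  case: (eqVneq k i) => [->|ki']; first by lra.
  case: (eqVneq k j) => [->|kj'].
    by rewrite ePj; move: eP'j; case: (s) => /=; lra.
  by have [-> ->] := ePk k kj'; have [-> ->] := eP'k k kj'; have [-> ->] := eqKL k ki'; lra.
have := nP j; have := nP' j; have := meeting_cells j PM P'M Px P'x.
by move: ePj eP'j; case: (s) => /= ? ? [[]|?|?] //; lra.
Qed.

(** Needed since the neighbour is only chosen among the faces [f'] such that
    [across f j s f']; the transport telescopes because this choice is forced,
    hence symmetric. *)
Lemma across_unique i K L j s f' f'' : stacked i K L ->
  across (face_of K i true) j s f' -> across (face_of K i true) j s f'' ->
  f' = f''.
Proof.
move=> KL a' a''; have [ji|ji] := eqVneq j i.
  by subst j; rewrite (across_direct KL a') (across_direct KL a'').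
have [/EP[P [i1 [t [PM f'E]]]] i1E _ _] := a'.
have [/EP[P'' [i2 [t'' [P''M f''E]]]] i2E _ _] := a''.
rewrite f'E/= in i1E; rewrite f''E/= in i2E; subst i1 i2.
have := across_lateral KL ji a' PM f'E; have := across_lateral KL ji a'' P''M f''E.
rewrite f'E f''E; case: t t'' {f'E f''E} => [] [] e'' e'.
- by rewrite (cell_of_face_unique PM P''M (i := j) (s := ~~ s)) ?e'.
- by have [] := stacked_beside KL ji PM P''M e' e''.
- by have [] := stacked_beside KL ji P''M PM e'' e'.
- by rewrite (cell_of_face_unique PM P''M (i := j) (s := ~~ s)) ?e'.
Qed.

(** Converse of [across_lateral]. When [P] has no cell of the grid on the other
    side of [face_of P i t], the dual cell of this face stops there, which is why
    an inclusion of dual faces, and not an equality, holds at a re-entrant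
    corner. *)
Lemma across_beside i K L j s t P : stacked i K L -> j != i -> P \in M ->
  face_of P j (~~ s) = face_of (if t then K else L) j s ->
  across (face_of K i true) j s (face_of P i t).
Proof.
move=> KL ji PM eP; have [KM LM KLe] := KL.
have [eKL eqKL] := stacked_coord KL.
have ij : i != j by rewrite eq_sym.
have [ePj ePk] := iffLR (face_of_eqP _ _ _ _ _) eP.
have {}ePj : (if ~~ s then P.2 else P.1) 0 j = (if s then K.2 else K.1) 0 j.
  by rewrite ePj; have [e1 e2] := eqKL j ji; case: (s) (t) => [] [].
have {}ePk' k : k != i -> k != j -> P.1 0 k = K.1 0 k /\ P.2 0 k = K.2 0 k.
  by move=> ki kj; have := ePk k kj; have := eqKL k ki; case: (t) => -[-> ->] [-> ->].
have nP k := ndeg k PM; have nK k := ndeg k KM; have nL k := ndeg k LM.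
have mids : mid K i <= mid (cell M (face_of P i t) false) i /\
    mid (cell M (face_of P i t) true) i <= mid L i.
  have [eP1 eP2] := ePk i ij.
  (* the cell across [face_of P i t], if any, lies beside the other cell of [f] *)
  have far : mid (cell M (face_of P i t) t) i = K.2 0 i \/
      mid (cell M (face_of P i t) t) i = mid (if t then L else K) i.
    have [->|[]] := cell_cases (face_of P i t) t.
      by left; rewrite mid_flat; move: eP1 eP2; case: (t) => eP1 eP2; lra.
    set P' := cell _ _ _ => P'M /face_of_eqP[eP' eqP']; right.
    set Z := if t then L else K.
    have ZM : Z \in M by rewrite /Z; case: (t).
    pose x := \row_k if k == i then K.2 0 i else if k == j
      then (if s then K.2 else K.1) 0 j else K.1 0 k.
    have Zx : box_set Z x.
      move=> k; rewrite mxE /Z; have := nK k; have := nL k.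
      case: (eqVneq k i) => [->|ki]; first by case: (t); lra.
      case: (eqVneq k j) => [->|kj].
        by have [e1 e2] := eqKL j ji; case: (s) (t) => [] []; lra.
      by have [e1 e2] := eqKL k ki; case: (t); lra.
    have P'x : box_set P' x.
      move=> k; rewrite mxE; have := ndeg k P'M.
      case: (eqVneq k i) => [->|ki].
        by move: eP' eP1 eP2; rewrite eKL; case: (t) => /=; lra.
      have [<- <-] := eqP' k ki; have := nK k; have := nP k.
      case: (eqVneq k j) => [->|kj].
        by rewrite -ePj; case: (s); lra.
      by have [-> ->] := ePk' k ki kj; lra.
    rewrite /mid; have := ndeg i P'M; have := ndeg i ZM.
    move: (meeting_cells i P'M ZM P'x Zx) eP' eP1 eP2; rewrite /Z.
    by case: (t) => /= -[[-> ->]|?|?] //; lra.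
  have near' : mid (cell M (face_of P i t) (~~ t)) i = mid (if t then K else L) i.
    by rewrite cell_face// /mid eP1 eP2.
  move: far near'; rewrite /mid.
  have := nK i; have := nL i.
  by case: (t) => /= ? ? [->|->] ->; lra.
split=> //.
- by apply/EP; exists P, i, t.
- case/face_of_eqP => _ /(_ j ji)[]; have := nP j; have := nK j.
  by move: ePj; case: (s) => /=; lra.
move=> x ex k; have := ex k; rewrite !face_loE !face_hiE.
have [e1 e2] := dual_stackedE k KL.
have [->|kj] := eqVneq k j.
  by rewrite !dual_endE (negPf ji) ePj.
rewrite e1 e2 dual_loE dual_hiE.
by have [_|ki] := eqVneq k i; [lra|have [-> ->] := ePk' k ki kj].
Qed.

(** * Dual fluxes *)

Variables (gamma eps dt : R) (eta : face R d -> R) (phiM : box R d -> R).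
Variables (rho : box R d -> R) (u : face R d -> R).
Local Notation F := (flux M gamma eps dt eta phiM rho u).
Local Notation Fd := (dual_flux Om M gamma eps dt eta phiM rho u).
Local Notation up := (u_up Om M gamma eps dt eta phiM rho u).

Lemma flux_ext f K : f \notin E_int M -> F f K = 0.
Proof. by rewrite /flux => /negPf ->. Qed.

Lemma flux_opp P Q j s : P \in M -> Q \in M ->
  face_of P j s = face_of Q j (~~ s) ->
  F (face_of P j s) P = - F (face_of P j s) Q.
Proof.
move=> PM QM e; rewrite /flux; case: ifP => _; last by rewrite oppr0.
rewrite normal_face; last exact: ndeg.
rewrite -mulrN; congr (_ * _); rewrite e normal_face; last exact: ndeg.
by case: s {e}; rewrite ?opprK.
Qed.

Lemma not_outer_boundary (b : box R d) (x : 'rV[R]_d) :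
  box_set b `<=` closure Om -> (forall k, b.1 0 k < x 0 k < b.2 0 k) ->
  ~ outer_boundary Om x.
Proof.
move=> bOm xb [_]; apply; change (nbhs x (closure Om)).
have near_k (k : 'I_d) :
    \forall y \near x, b.1 0 k < (y : 'rV[R]_d) 0 k < b.2 0 k.
  have nb : nbhs (x 0 k) [set z | b.1 0 k < z < b.2 0 k].
    have := @near_in_itvoo R (b.1 0 k) (b.2 0 k) (x 0 k).
    by rewrite in_itv/= xb => /(_ isT); apply: filterS => y; rewrite in_itv.
  exact: (@coord_continuous R 1 d 0 k x _ nb).
apply: (filterS _ (filter_forall _ near_k)) => y yb.
by apply: bOm => k; have := yb k; lra.
Qed.

Lemma cell_in_domain K : K \in M -> box_set K `<=` closure Om.
Proof. by move=> KM x Kx; rewrite (mesh_cover hM); exists K. Qed.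

(** The boundary test never succeeds here: the dual face contains the centre of a
    cell. *)
Lemma dual_flux_direct i K L s : stacked i K L ->
  Fd (face_of K i true) (dual_face (face_of K i true) i s) =
  (F (face_of (if s then L else K) i s) (if s then L else K)
   - F (face_of K i true) (if s then L else K)) / 2.
Proof.
move=> KL; have [KM LM _] := KL; set Q := if s then L else K.
rewrite /dual_flux is_upper_face; last exact: (dual_stacked_ndeg KL).
have cQ : cell M (face_of K i true) s = Q.
  by rewrite /Q; have [] := cell_stacked KL; case: (s).
case: ifP => [/asboolP sub|_]; last by rewrite eqxx cQ.
exfalso; have QM : Q \in M by rewrite /Q; case: (s).
have [_ eqKL] := stacked_coord KL.
pose x : 'rV[R]_d := \row_k mid Q k.
apply: (@not_outer_boundary Q x).
- exact: cell_in_domain.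
- by move=> k; rewrite mxE /mid; have := ndeg k QM; lra.
apply: sub => k; rewrite face_loE face_hiE.
have [->|ki] := eqVneq k i; first by rewrite dual_endE eqxx mxE cQ lexx.
have [-> ->] := dual_stackedE k KL; rewrite (negPf ki) mxE /mid.
have := ndeg k QM; rewrite /Q; case: (s); last by lra.
by have [-> ->] := eqKL k ki; lra.
Qed.

(** Were the face of [Q] internal, the union of [Q] and the cell across it would
    be a box of the closed domain, with points of the dual face in its
    interior. *)
Lemma flux_boundary i K L j s Q : stacked i K L -> j != i ->
  Q = K \/ Q = L ->
  box_set (dual_face (face_of K i true) j s).2 `<=` outer_boundary Om ->
  F (face_of Q j s) Q = 0.
Proof.
move=> KL ji QKL sub; apply: flux_ext; apply/negP => /E_intP [k [A [B [AB e]]]].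
have kj : k = j by case: e.
subst k; have [AM BM _] := AB; have [KM LM _] := KL.
have [eAB eqAB] := stacked_coord AB; have [eKL eqKL] := stacked_coord KL.
have [eQj eQk] := iffLR (face_of_eqP _ _ _ _ _) e.
have ij : i != j by rewrite eq_sym.
have QM : Q \in M by case: QKL => ->.
have QK k : k != i -> Q.1 0 k = K.1 0 k /\ Q.2 0 k = K.2 0 k.
  by move=> ki; case: QKL => -> //; have [-> ->] := eqKL k ki.
(* in the [i] direction, [x] is kept strictly between the plane of
   [face_of K i true] and the middle of [Q], in order to lie both in [Q] and in the
   dual cell *)
pose x : 'rV[R]_d := \row_k if k == j then (if s then Q.2 else Q.1) 0 j
  else if k == i then (K.2 0 i + mid Q i) / 2 else mid Q k.
have nK := ndeg i KM; have nL := ndeg i LM; have nQ k := ndeg k QM.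
apply: (@not_outer_boundary (A.1, B.2) x).
- move=> y yb; have [le|ge] := leP (y 0 j) (A.2 0 j).
    apply: (cell_in_domain AM) => k; have := yb k => /=.
    by have [->|kj] := eqVneq k j; [lra|have [_ <-] := eqAB k kj].
  apply: (cell_in_domain BM) => k; have := yb k => /=.
  by have [->|kj] := eqVneq k j; [lra|have [<- _] := eqAB k kj].
- move=> k; rewrite mxE /=.
  have [->|kj] := eqVneq k j.
    by rewrite eQj/=; have := ndeg j AM; have := ndeg j BM; lra.
  have [_ <-] := eqAB k kj; have [<- <-] := eQk k kj; rewrite /mid.
  have [->|ki] := eqVneq k i; last by have := nQ k; lra.
  by case: QKL => ->; lra.
apply: sub => k; rewrite face_loE face_hiE.
have xE : x 0 k = if k == j then (if s then Q.2 else Q.1) 0 j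
  else if k == i then (K.2 0 i + mid Q i) / 2 else mid Q k by rewrite mxE.
move: xE; case: (eqVneq k j) => [_|kj] ->.
  by rewrite dual_endE (negPf ji); have [e1 e2] := QK j ji; case: (s); lra.
have [-> ->] := dual_stackedE k KL; rewrite /mid.
have [_|ki] := eqVneq k i; first by case: QKL => ->; lra.
by have [-> ->] := QK k ki; have := ndeg k KM; lra.
Qed.

(** The boundary test may succeed here, but the right-hand side then vanishes. *)
Lemma dual_flux_lateral i K L j s : stacked i K L -> j != i ->
  Fd (face_of K i true) (dual_face (face_of K i true) j s) =
  (F (face_of K j s) K + F (face_of L j s) L) / 2.
Proof.
move=> KL ji; rewrite /dual_flux is_upper_face; last exact: (dual_stacked_ndeg KL).
case: ifP => [/asboolP sub|_]; last first.
  have -> : ((dual_face (face_of K i true) j s).1 == i) = false := negPf ji.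
  by have [-> ->] := cell_stacked KL.
rewrite (flux_boundary KL ji _ sub); last by left.
by rewrite (flux_boundary KL ji _ sub); [rewrite addr0 mul0r|right].
Qed.

(** In the direction of [f], both fluxes are half the difference of the fluxes
    through [f] and [f'] out of the cell between them, taken in opposite orders.
    Laterally, both are computed from the same two faces of the grid, but out of
    the cells lying on opposite sides of them. *)
Lemma across_int_opp i K L j s f' : stacked i K L ->
  let f := face_of K i true in
  f' \in E_int M -> across f j s f' ->
  dual_face f' j (~~ s) = dual_face f j s /\
  Fd f' (dual_face f' j (~~ s)) = - Fd f (dual_face f j s).
Proof.
move=> KL f /E_intP [i' [P [P' [PP' f'E]]]] acr.
have i'i : i' = i by case: acr => _ + _ _; rewrite f'E.
subst i'; have [PM P'M ePP'] := PP'; have [KM LM eKL] := KL.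
have [ji|ji] := eqVneq j i.
  subst j; set Q := if s then L else K.
  have QM : Q \in M by rewrite /Q; case: (s).
  have f'Q : f' = face_of Q i s by exact: across_direct acr.
  have fQ : f = face_of Q i (~~ s) by rewrite /f /Q; case: (s).
  have QE : (if ~~ s then P' else P) = Q.
    apply: (cell_of_face_unique (i := i) (s := s)) => //.
      by case: (s).
    by rewrite -f'Q f'E; case: (s).
  have de : dual_face f' i (~~ s) = dual_face f i s.
    apply/face_of_eqP; split.
      rewrite f'E !dual_endE !eqxx; have [c1 c2] := cell_stacked KL.
      have [c1' c2'] := cell_stacked PP'.
      by move: QE; rewrite /Q; case: (s) => /= QE; rewrite ?c1 ?c2 ?c1' ?c2' QE.
    by move=> k ki; rewrite f'Q fQ !dual_loE !dual_hiE (negPf ki).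
  split=> //; rewrite /f (dual_flux_direct s KL) -/f -/Q.
  have := dual_flux_direct (~~ s) PP'; rewrite -f'E QE => ->.
  by rewrite -fQ f'Q -/Q; lra.
have eP : face_of P j (~~ s) = face_of K j s.
  exact: (across_lateral KL ji acr PM f'E).
have eP' : face_of P' j (~~ s) = face_of L j s.
  by apply: (across_lateral (t := false) KL ji acr P'M); rewrite f'E.
have de : dual_face f' j (~~ s) = dual_face f j s.
  have [ePj ePk] := iffLR (face_of_eqP _ _ _ _ _) eP.
  have [_ eP'k] := iffLR (face_of_eqP _ _ _ _ _) eP'.
  apply/face_of_eqP; split; first by rewrite f'E !dual_endE (negPf ji).
  move=> k kj; rewrite f'E; have [-> ->] := dual_stackedE k PP'.
  have [-> ->] := dual_stackedE k KL; rewrite /mid.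
  have [e1 e2] := ePk k kj; have [e1' e2'] := eP'k k kj.
  by have [ki|_] := eqVneq k i; [rewrite -ki e1 e2 e1' e2'|].
split=> //; rewrite /f (dual_flux_lateral s KL ji) -/f.
have := dual_flux_lateral (~~ s) PP' ji; rewrite -f'E => ->.
have := flux_opp PM KM (j := j) (s := ~~ s); rewrite negbK eP => /(_ erefl) ->.
have := flux_opp P'M LM (j := j) (s := ~~ s); rewrite negbK eP' => /(_ erefl) ->.
lra.
Qed.

(** The lateral flux through a dual face is nonzero only if one of the two half
    faces forming it is internal; the cell behind this half face then carries
    the neighbour. *)
Lemma across_exists i K L j s : stacked i K L ->
  let f := face_of K i true in
  Fd f (dual_face f j s) != 0 -> exists f', across f j s f'.
Proof.
move=> KL f; have [KM LM eKL] := KL; have [->|ji] := eqVneq j i.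
  move=> _; set Q := if s then L else K; exists (face_of Q i s).
  have QM : Q \in M by rewrite /Q; case: (s).
  have fQ : f = face_of Q i (~~ s) by rewrite /f /Q; case: (s).
  split=> //; first by apply/EP => //; exists Q, i, s.
    rewrite fQ => /face_of_eqP[+ _]; have := ndeg i QM.
    by case: (s) => /=; lra.
  suff -> : dual_face (face_of Q i s) i (~~ s) = dual_face f i s by [].
  apply/face_of_eqP; split.
    rewrite !dual_endE !eqxx cell_face//; have [c1 c2] := cell_stacked KL.
    by rewrite /Q; case: (s); rewrite ?c1 ?c2.
  by move=> k ki; rewrite fQ !dual_loE !dual_hiE (negPf ki).
rewrite /f (dual_flux_lateral s KL ji) -/f => nz.
have next Q : Q \in M -> F (face_of Q j s) Q != 0 -> exists2 P, P \in M &
    face_of P j (~~ s) = face_of Q j s.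
  move=> QM; have [/E_intP [k [A [B [[AM BM AB]]]]] e _|/flux_ext ->] :=
    boolP (face_of Q j s \in E_int M); last by rewrite eqxx.
  have kj : k = j by case: e.
  by subst k; rewrite e; case: (s); [exists B|exists A].
have [KF|KF] := eqVneq (F (face_of K j s) K) 0; last first.
  have [P PM eP] := next K KM KF.
  by exists (face_of P i true); apply: across_beside KL _ _ _.
have LF : F (face_of L j s) L != 0.
  by apply: contraNneq nz => ->; rewrite KF addr0 mul0r.
have [P PM eP] := next L LM LF.
by exists (face_of P i false); apply: across_beside KL _ _ _.
Qed.

(** The two fluxes through [f] itself cancel, since they are opposite; hence the
    dual densities satisfy a mass balance too. *)
Lemma dual_flux_sum i K L : stacked i K L ->
  \sum_(e <- faces (dual_cell M (face_of K i true))) Fd (face_of K i true) e =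
  (\sum_(g <- faces K) F g K + \sum_(g <- faces L) F g L) / 2.
Proof.
move=> KL; have [KM LM e] := KL.
rewrite !big_faces; [|exact: mesh_nondegenerate hM _ LM
  |exact: mesh_nondegenerate hM _ KM|exact: (dual_stacked_ndeg KL)].
rewrite -(pair_bigA _ (fun j s => Fd _ (dual_face _ j s)))/=.
rewrite -(pair_bigA _ (fun j s => F (face_of K j s) _))/=.
rewrite -(pair_bigA _ (fun j s => F (face_of L j s) _))/=.
rewrite -big_split/= mulr_suml; apply: eq_bigr => j _.
rewrite !big_bool/=.
have [->|ji] := eqVneq j i.
  rewrite (dual_flux_direct true KL) (dual_flux_direct false KL).
  by have := flux_opp KM LM (j := i) (s := true) e; rewrite -e; lra.
by rewrite !(dual_flux_lateral _ KL ji); lra.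
Qed.

(** * Transport of kinetic energy and discrete integration by parts *)

Lemma u_upE i K L j s : stacked i K L ->
  let f := face_of K i true in let e := dual_face f j s in
  up f e = if 0 <= Fd f e then u f else u (xget f (across f j s)).
Proof.
move=> KL f e; rewrite /u_up /dual_neighbour is_upper_face//.
exact: (dual_stacked_ndeg KL).
Qed.

Lemma across_sym f j s f' : f \in E_int M -> f' \in E_int M ->
  across f j s f' -> across f' j (~~ s) f.
Proof.
move=> fI f'I acr; have [i [K [L [KL fE]]]] := E_intP _ fI.
subst f; have [_ e1 e2 _] := acr.
have [de _] := across_int_opp KL f'I acr; split.
- by apply/EP; exists K, i, true; have [] := KL.
- by rewrite e1.
- by move=> e; apply: e2.
- by rewrite negbK de.
Qed.

(** Twice the kinetic energy carried from [f] to [f'], the upwind value being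
    taken as if [f'] were the neighbour of [f]. *)
Definition transfer f j s f' : R :=
  let x := Fd f (dual_face f j s) in x * (if 0 <= x then u f else u f') ^+ 2.

(** Opposite fluxes select the same upwind value. *)
Lemma transfer_opp f j s f' : f \in E_int M -> f' \in E_int M ->
  across f j s f' -> transfer f' j (~~ s) f = - transfer f j s f'.
Proof.
move=> fI f'I acr; have [i [K [L [KL fE]]]] := E_intP _ fI.
subst f; have [_ opp] := across_int_opp KL f'I acr.
rewrite /transfer opp oppr_ge0 mulNr; congr (- _).
by case: ltgtP => [_|_|->]; rewrite ?mul0r.
Qed.

(** The symmetry of [across] and [transfer_opp] make the summand antisymmetric in
    [f] and [f'], once the side [s] of the dual face is exchanged. *)
Lemma transfer_sum0 : \sum_(f <- E_int M) \sum_(f' <- E_int M)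
  \sum_(q : 'I_d * bool | `[< across f q.1 q.2 f' >]) transfer f q.1 q.2 f' = 0.
Proof.
set A := fun f f' =>
  \sum_(q : 'I_d * bool | `[< across f q.1 q.2 f' >]) transfer f q.1 q.2 f'.
have Aopp f f' : f \in E_int M -> f' \in E_int M -> A f' f = - A f f'.
  move=> fI f'I; rewrite /A -sumrN.
  pose opp (q : 'I_d * bool) := (q.1, ~~ q.2).
  have oppK : involutive opp by case=> j s; rewrite /opp/= negbK.
  rewrite (reindex_inj (inv_inj oppK))/=; apply: eq_big => [[j s]|[j s] /asboolP acr]/=.
    apply/asboolP/asboolP => [/(across_sym f'I fI)|/(across_sym fI f'I)//].
    by rewrite negbK.
  apply: transfer_opp => //.
  by have := across_sym f'I fI acr; rewrite negbK.
suff : \sum_(f <- E_int M) \sum_(f' <- E_int M) A f f' =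
       - \sum_(f <- E_int M) \sum_(f' <- E_int M) A f f' by lra.
rewrite [LHS]exchange_big -sumrN big_seq [RHS]big_seq; apply: eq_bigr => f fI.
rewrite -sumrN big_seq [RHS]big_seq; apply: eq_bigr => f' f'I.
exact: Aopp.
Qed.

(** The sum on the left has at most one term, the one of the actual neighbour. If
    this neighbour is external, its velocity is zero, so that the right-hand
    side is nonnegative whatever the sign of the flux. *)
Lemma transfer_le f j s : velocity_space M u -> f \in E_int M ->
  \sum_(f' <- E_int M | `[< across f j s f' >]) transfer f j s f'
  <= Fd f (dual_face f j s) * up f (dual_face f j s) ^+ 2.
Proof.
move=> hu fI; have [i [K [L [KL fE]]]] := E_intP _ fI.
subst f; set f := face_of K i true; rewrite (u_upE _ _ KL) -/f.
have [x0|nz] := eqVneq (Fd f (dual_face f j s)) 0.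
  by rewrite x0 mul0r big1// => f' _; rewrite /transfer -/f x0 mul0r.
have ex := across_exists KL nz; have acr := xgetPex f ex.
set f' := xget _ _ in acr *; rewrite -[leRHS]/(transfer f j s f').
have [f'I|f'E] := boolP (f' \in E_int M).
  rewrite big_mkcond (bigD1_seq f') ?fset_uniq//= big1 ?addr0; last first.
    move=> f'' nf; case: asboolP => // acr''.
    by rewrite (across_unique KL acr'' acr) eqxx in nf.
  by case: asboolP.
rewrite big_seq_cond big1; last first.
  move=> f'' /andP[f''I /asboolP acr''].
  by rewrite (across_unique KL acr'' acr) (negPf f'E) in f''I.
rewrite /transfer -/f; case: ifP => [x0|_]; first by rewrite mulr_ge0 ?sqr_ge0.
rewrite hu ?expr0n ?mulr0// /E_ext in_fsetD f'E.
by case: acr.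
Qed.

Lemma dual_transport_ge0 : velocity_space M u ->
  0 <= \sum_(f <- E_int M) \sum_(e <- faces (dual_cell M f)) Fd f e * up f e ^+ 2.
Proof.
move=> hu; rewrite -[leLHS]transfer_sum0 big_seq [leRHS]big_seq.
apply: ler_sum => f fI.
have [i [K [L [KL fE]]]] := E_intP _ fI.
rewrite big_faces; last by rewrite fE; exact: dual_stacked_ndeg KL.
rewrite (exchange_big_dep predT)//=; apply: ler_sum => -[j s] _ /=.
exact: transfer_le.
Qed.

(** Used to exchange the order of summation over cells and over internal faces. *)
Lemma big_uniq_cond (T : choiceType) (r1 r2 : seq T) (g : T -> R) :
  uniq r1 -> uniq r2 -> (forall x, x \in r1 -> x \notin r2 -> g x = 0) ->
  \sum_(x <- r1) g x = \sum_(x <- r2 | x \in r1) g x.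
Proof.
move=> u1 u2 g0.
rewrite (bigID (mem r2))/= [X in _ + X]big1_seq ?addr0; last first.
  by move=> x /andP[/= ? ?]; apply: g0.
rewrite -[LHS]big_filter -[RHS]big_filter; apply: perm_big.
apply: uniq_perm; rewrite ?filter_uniq// => x.
by rewrite !mem_filter andbC.
Qed.

(** Each internal face is seen from its two cells with opposite fluxes. *)
Lemma primal_sum (g : box R d -> R) :
  \sum_(K <- M) g K * (\sum_(f <- faces K) F f K) =
  \sum_(f <- E_int M) F f (cell M f false) * (g (cell M f false) - g (cell M f true)).
Proof.
under eq_bigr => K _.
  rewrite (big_uniq_cond (r2 := E_int M)) ?fset_uniq//; last first.
    by move=> f _; exact: flux_ext.
  rewrite mulr_sumr; over.
rewrite (exchange_big_dep predT)//= big_seq [RHS]big_seq; apply: eq_bigr => f fI.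
have [i [K [L [KL fE]]]] := E_intP _ fI; have [KM LM e] := KL.
subst f; have [-> ->] := cell_stacked KL; set f := face_of K i true.
have KnL : K != L.
  apply/eqP => KL'; subst L; move/face_of_eqP: e => [/= e _].
  by have := ndeg i KM; lra.
have fP P : P \in M -> (f \in faces P) = (P \in [:: K; L]).
  move=> PM; rewrite mem_faces !inE; apply/existsP/idP.
    move=> [[j t]/= /eqP fE]; have ji : i = j by case: fE.
    subst j; case: t fE => fE; apply/orP; [left|right]; apply/eqP.
      by rewrite (cell_of_face_unique KM PM (i := i) (s := true)).
    by rewrite (cell_of_face_unique LM PM (i := i) (s := false))// -e.
  by case/orP => /eqP ->; [exists (i, true)|exists (i, false); rewrite /f e].
rewrite big_seq_cond (eq_bigl (fun P => (P \in M) && (P \in [:: K; L]))); last first.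
  by move=> P; have [/fP->|] := boolP (P \in M).
rewrite -big_seq_cond -big_uniq_cond ?fset_uniq//=; last 2 first.
- by rewrite inE KnL.
- by move=> P; rewrite !inE => /orP[] /eqP ->; rewrite ?KM ?LM.
rewrite !big_cons big_nil.
have -> : F f L = - F f K.
  have := flux_opp KM LM (j := i) (s := true) e; rewrite -/f; lra.
by ring.
Qed.

End Mesh.

(** * Discrete energy balances *)

Section Energy.
Local Set Implicit Arguments.
Local Unset Strict Implicit.
Context {R : realType} {d : nat} (Om : set 'rV[R]_d) (M : {fset box R d}).
Hypothesis hM : MAC_mesh M Om.
Variables (gamma eps dt C : R) (eta : face R d -> R) (phi : 'rV[R]_d -> R).
Hypotheses (gamma_gt1 : 1 < gamma) (eps_gt0 : 0 < eps) (dt_gt0 : 0 < dt).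
Variables (rho0 rho1 : box R d -> R) (u0 : face R d -> R).
Hypotheses (rho0_gt0 : density_positive M rho0)
  (rho1_gt0 : density_positive M rho1).

Local Notation phiM := (phi_cell gamma C phi).
Local Notation rhoM := (rho_hyd_cell gamma C phi).
Local Notation h' := (derive1 (h gamma)).
Local Notation F := (flux M gamma eps dt eta phiM rho1 u0).
Local Notation Fd := (dual_flux Om M gamma eps dt eta phiM rho1 u0).
Local Notation D f := (vol (dual_cell M f)).
Local Notation G := (force M gamma phiM rho1).

Hypothesis mass : mass_eq M gamma eps dt eta phiM rho0 u0 rho1.

Lemma vol_gt0 (b : box R d) : Defs.nondegenerate b -> 0 < vol b.
Proof. by move=> nb; apply: prodr_gt0 => i _; rewrite subr_gt0. Qed.

Lemma cell_vol_gt0 K : K \in M -> 0 < vol K.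
Proof. by move=> KM; apply: vol_gt0; exact: mesh_nondegenerate hM _ KM. Qed.

Lemma dual_vol_gt0 f : f \in E_int M -> 0 < D f.
Proof.
move=> /(E_intP hM)[i [K [L [KL ->]]]]; apply: vol_gt0.
exact: dual_stacked_ndeg hM _ _ _ KL.
Qed.

Lemma mass_cell K : K \in M ->
  vol K * (rho1 K - rho0 K) = - dt * \sum_(f <- faces K) F f K.
Proof.
move=> KM; have := mass KM; set S := \sum_(f <- _) _ => e.
have v0 := cell_vol_gt0 KM.
have -> : S = - (vol K * (rho1 K - rho0 K) / dt).
  have -> : S = vol K * (1 / vol K * S) by field; rewrite gt_eqF.
  have -> : 1 / vol K * S = - ((rho1 K - rho0 K) / dt) by lra.
  by ring.
by field; rewrite gt_eqF.
Qed.

Lemma dual_avgE q f : f \in E_int M -> D f * dual_avg M q f =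
  vol (cell M f false) / 2 * q (cell M f false)
  + vol (cell M f true) / 2 * q (cell M f true).
Proof.
by move=> fI; rewrite /dual_avg mulrC divfK// gt_eqF// dual_vol_gt0.
Qed.

Lemma dual_avg_gt0 f : f \in E_int M -> 0 < dual_avg M rho1 f.
Proof.
move=> fI; have [i [K [L [KL fE]]]] := E_intP hM _ fI; have [KM LM _] := KL.
rewrite divr_gt0 ?dual_vol_gt0// fE; have [-> ->] := cell_stacked hM KL.
by rewrite addr_gt0 ?mulr_gt0 ?invr_gt0 ?cell_vol_gt0 ?rho1_gt0.
Qed.

Lemma dual_mass f : f \in E_int M ->
  D f * (dual_avg M rho1 f - dual_avg M rho0 f) / dt
  + \sum_(e <- faces (dual_cell M f)) Fd f e = 0.
Proof.
move=> fI; have [i [K [L [KL fE]]]] := E_intP hM _ fI; have [KM LM _] := KL.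
rewrite mulrBr !dual_avgE// fE (dual_flux_sum hM _ _ _ _ _ _ _ KL).
have [-> ->] := cell_stacked hM KL.
have := mass_cell KM; have := mass_cell LM.
set SK := \sum_(g <- faces K) _; set SL := \sum_(g <- faces L) _ => eL eK.
have -> : vol K / 2 * rho1 K + vol L / 2 * rho1 L
    - (vol K / 2 * rho0 K + vol L / 2 * rho0 L) = - dt * (SK + SL) / 2 by lra.
by field; rewrite gt_eqF.
Qed.

Lemma normal_lower f : f \in E_int M -> normal f (cell M f false) = 1.
Proof.
move=> /(E_intP hM)[i [K [L [KL ->]]]]; have [-> _] := cell_stacked hM KL.
by rewrite normal_face//; apply: mesh_nondegenerate hM _ _ _; case: KL.
Qed.

(** The definition of the interface density replaces the jump of [h'] times that
    density by the jump of the pressure, and [h'(rhoM K)] is [C - phiM K]. *)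
Lemma flux_work f : f \in E_int M ->
  let g K := h' (rho1 K) - h' (rhoM K) in
  D f * ((u0 f - eta f * dt / eps ^+ 2 * G f) * G f) =
  - (F f (cell M f false) * (g (cell M f false) - g (cell M f true))).
Proof.
move=> fI g; rewrite /flux /delta_u fI normal_lower// /force /grad normal_lower//.
have [i [K [L [KL fE]]]] := E_intP hM _ fI; have [KM LM _] := KL.
have D0 := dual_vol_gt0 fI.
rewrite /rho_face; have [-> ->] : cell M f false = K /\ cell M f true = L.
  by rewrite fE; exact: (cell_stacked hM KL).
have := interface_valueP gamma_gt1 (rho1_gt0 KM) (rho1_gt0 LM).
rewrite /g/= /pressure /phi_cell.
set r := interface_value _ _ _.
set pK := rho1 K `^ gamma; set pL := rho1 L `^ gamma => e.
move: (h' (rho1 K)) (h' (rho1 L)) (h' (rhoM K)) (h' (rhoM L)) e => hK hL bK bL.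
clearbody pK pL r; move: (area f) (D f) D0 (eta f) (u0 f) => a V V0 et u /= e.
have {e} -> : pK = pL + r * (hK - hL) by lra.
by field; rewrite !gt_eqF.
Qed.

(** The mass balance is tested with [h'(rho1) - h'(rhoM)], which is
    [h'(rho1) + phiM] up to a constant; the inequality is the convexity of [h]. *)
Lemma potential_balance :
  (\sum_(K <- M) vol K * Pi gamma (rho1 K) (rhoM K))
  - (\sum_(K <- M) vol K * Pi gamma (rho0 K) (rhoM K))
  <= dt * \sum_(f <- E_int M)
       D f * ((u0 f - eta f * dt / eps ^+ 2 * G f) * G f).
Proof.
pose g K := h' (rho1 K) - h' (rhoM K).
have -> : \sum_(f <- E_int M) D f * ((u0 f - eta f * dt / eps ^+ 2 * G f) * G f)
    = - (\sum_(K <- M) g K * \sum_(f <- faces K) F f K).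
  rewrite (primal_sum hM) -sumrN big_seq [RHS]big_seq.
  by apply: eq_bigr => f; exact: flux_work.
rewrite mulrN -mulNr mulr_sumr -sumrB big_seq [leRHS]big_seq.
apply: ler_sum => K KM; rewrite mulrCA -mass_cell// -mulrBr mulrCA.
apply: ler_wpM2l; first exact/ltW/cell_vol_gt0.
exact: (Pi_diff_le gamma_gt1 _ (rho0_gt0 KM) (rho1_gt0 KM)).
Qed.

End Energy.

Theorem theorem5p4 (R : realType) (d : nat) (hd : (1 <= d <= 3)%N)
  (gamma eps dt : R) (hgamma : 1 < gamma) (heps : 0 < eps <= 1) (hdt : 0 < dt)
  (Om : set 'rV[R]_d) (hOm : MAC_domain Om)
  (phi : 'rV[R]_d -> R) (m0 C : R) (hC : hydrostatic_data gamma C phi Om m0)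
  (M : {fset box R d}) (hM : MAC_mesh M Om)
  (eta : face R d -> R) (heta : forall f, f \in E_int M -> 0 < eta f)
  (rho0 rho1 : box R d -> R) (u0 u1 : face R d -> R)
  (hrho0 : density_positive M rho0) (hu0 : velocity_space M u0) :
  let rhoM := rho_hyd_cell gamma C phi in
  let phiM := phi_cell gamma C phi in
  solution Om M gamma eps dt eta phiM rho0 u0 rho1 u1 ->
  (forall f, f \in E_int M ->
     dt / vol (dual_cell M f)
     * (\sum_(e <- faces (dual_cell M f))
          negpart (dual_flux Om M gamma eps dt eta phiM rho1 u0 f e)
          / dual_avg M rho1 f) <= 1 / 2) ->
  (forall f, f \in E_int M -> 1 / dual_avg M rho1 f <= eta f) ->
  1 / eps ^+ 2 * (\sum_(K <- M) vol K * Pi gamma (rho1 K) (rhoM K))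
  + \sum_(f <- E_int M)
      vol (dual_cell M f) * (1 / 2 * dual_avg M rho1 f * u1 f ^+ 2)
  <= 1 / eps ^+ 2 * (\sum_(K <- M) vol K * Pi gamma (rho0 K) (rhoM K))
  + \sum_(f <- E_int M)
      vol (dual_cell M f) * (1 / 2 * dual_avg M rho0 f * u0 f ^+ 2).
Proof.
move=> rhoM phiM [rho1_gt0 hu1 mass mom] cfl etage.
have eps0 : 0 < eps by case/andP: heps.
have pot := potential_balance hM hgamma eps0 hdt hrho0 rho1_gt0 mass.
have trans := dual_transport_ge0 hM gamma eps dt eta phiM rho1 hu0.
pose kin rho u f := vol (dual_cell M f)
  * (1 / 2 * dual_avg M rho f * (u : face R d -> R) f ^+ 2).
pose work f := vol (dual_cell M f)
  * ((u0 f - eta f * dt / eps ^+ 2 * force M gamma phiM rho1 f)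
     * force M gamma phiM rho1 f).
pose transport f := \sum_(e <- faces (dual_cell M f))
  dual_flux Om M gamma eps dt eta phiM rho1 u0 f e
  * u_up Om M gamma eps dt eta phiM rho1 u0 f e ^+ 2.
have kinetic f : f \in E_int M -> kin rho1 u1 f - kin rho0 u0 f
    + dt / eps ^+ 2 * work f + dt / 2 * transport f <= 0.
  move=> fI.
  have momf : (dual_avg M rho1 f * u1 f - dual_avg M rho0 f * u0 f) / dt
      + 1 / vol (dual_cell M f) * (\sum_(e <- faces (dual_cell M f))
          dual_flux Om M gamma eps dt eta phiM rho1 u0 f e
          * u_up Om M gamma eps dt eta phiM rho1 u0 f e)
      + 1 / eps ^+ 2 * force M gamma phiM rho1 f = 0.
    by have := mom f fI; rewrite /force/=; lra.
  have := local_kinetic_balance (dual_vol_gt0 hM fI) hdt eps0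
    (dual_avg_gt0 hM rho1_gt0 fI) (dual_mass hM hdt mass fI) momf
    (cfl f fI) (etage f fI).
  apply: le_trans; rewrite le_eqVlt; apply/orP; left; apply/eqP.
  by rewrite /kin /work; congr (_ + _ + _); ring.
have : \sum_(f <- E_int M) (kin rho1 u1 f - kin rho0 u0 f
    + dt / eps ^+ 2 * work f + dt / 2 * transport f) <= 0.
  by rewrite big_seq; apply: sumr_le0 => f; exact: kinetic.
rewrite !big_split sumrN/= -!mulr_sumr.
have : 0 <= dt / 2 * \sum_(f <- E_int M) transport f.
  by rewrite mulr_ge0// divr_ge0 ?ltW.
have ie0 : 0 <= 1 / eps ^+ 2 by rewrite divr_ge0 ?sqr_ge0.
have := ler_wpM2l ie0 pot.
have -> : 1 / eps ^+ 2 * (dt * \sum_(f <- E_int M) work f)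
    = dt / eps ^+ 2 * \sum_(f <- E_int M) work f by ring.
rewrite -/phiM -/rhoM.
lra.
Qed.
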